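(* Let $R>0$, $M\ge0$, $\sigma>0$, and let $\rho_r\in H^1_{ep}(\tilde X)\cap\mathcal P_e(\tilde X)$ be the radical opinions density. Consider the stationary equation $$\tfrac{\sigma^2}{2}\rho_{xx}+(\rho\,G_\rho)_x=0,\qquad G_\rho=w\star(\rho+M\rho_r).$$ (Existence) The stationary equation has an even, strictly positive, classical solution $\rho^s\in C^2_{ep}(\tilde X)\cap\mathcal P_e(\tilde X)$. (Estimate) Let $$\sigma_b^2:=\frac{4R}{\pi}\Big(M+\frac{R}{\sqrt3}+2\Big),\qquad c_b:=\frac{4R^2M}{\pi\sqrt3}.$$ For any $\eta>0$, if $\sigma^2>\sigma_b^2+\eta c_b$, then every such stationary solution $\rho^s$ satisfies $$\|\rho^s-1\|_{L^2}\le\frac1\eta\|\rho_r\|_{L^2}.$$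
   Context: $X=[0,1]$, $\tilde X=[-1,1]$. Functions on $\tilde X$ in the periodic spaces below are identified with their $2$-periodic extensions to $\mathbb R$. The function $w:\mathbb R\to\mathbb R$ is $w(\xi)=\xi$ if $|\xi|\le R$ and $w(\xi)=0$ if $|\xi|>R$, and $(w\star f)(x)=\int_{\mathbb R}w(x-y)f(y)\,dy=\int_{x-R}^{x+R}(x-y)f(y)\,dy$ for $2$-periodic $f$. $\mathcal P_e(\tilde X)$ is the set of functions $\rho:\tilde X\to[0,\infty)$ with $\int_X\rho(x)\,dx=1$ and $\rho(-x)=\rho(x)$. $H^1_{ep}(\tilde X)$ is the space of even functions $f\in H^1(\tilde X)=W^{1,2}(\tilde X)$ with $f(-1)=f(1)$. $C^2_{ep}(\tilde X)$ is the space of even, $2$-periodic, twice continuously differentiable functions on $\mathbb R$. The $L^2$ norms are over $\tilde X$. *)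

(* Defs.v *)
From HB Require Import structures.
From mathcomp Require Import all_boot all_order all_algebra.
From mathcomp Require Import all_classical all_reals all_analysis.
Set Implicit Arguments.
Unset Strict Implicit.
Unset Printing Implicit Defensive.
Import Order.TTheory GRing.Theory Num.Theory.
Import numFieldNormedType.Exports.
Local Open Scope ring_scope.
Local Open Scope classical_set_scope.

(* A function on [-1, 1] belonging to one of the periodic spaces is represented
   by its 2-periodic extension to the whole line. The radius of interaction is
   written r, since R is the type of real numbers. *)

Definition even_fun (R : realType) (f : R -> R) : Prop :=
  forall x : R, f (- x) = f x.

Definition leb_Xt (R : realType) :
    {measure set (measurableTypeR R) -> \bar R} :=
  mrestr (@lebesgue_measure R) (measurable_itv `[(-1 : R), 1]%R).

Definition L2norm (R : realType) (f : R -> R) : \bar R :=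
  ('N[leb_Xt R]_(2%:E)[EFin \o f])%E.

Definition test_fun (R : realType) (phi : R -> R) : Prop :=
  [/\ forall (n : nat) (x : R), derivable (phi^`(n)) x 1,
      compact (closure [set x | phi x != 0])
    & closure [set x | phi x != 0] `<=` `](-1), 1[ ].

Definition weak_derivative (R : realType) (f g : R -> R) : Prop :=
  forall phi : R -> R, test_fun phi ->
    \int[@lebesgue_measure R]_(x in `[-1, 1]) (f x * phi^`()%classic x) =
    - \int[@lebesgue_measure R]_(x in `[-1, 1]) (g x * phi x).

Definition H1 (R : realType) (f : R -> R) : Prop :=
  f \in Lfun (leb_Xt R) 2%:E /\
  exists2 g : R -> R, g \in Lfun (leb_Xt R) 2%:E & weak_derivative f g.

(* Elements of H^1 are taken through their continuous representative; for the
   2-periodic extension, f (-1) = f 1 is periodicity at -1, and makes the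
   extension continuous on the whole line. *)
Definition H1ep (R : realType) (f : R -> R) : Prop :=
  [/\ H1 f, continuous f, even_fun f & periodic f 2].

Definition C2ep (R : realType) (f : R -> R) : Prop :=
  [/\ even_fun f, periodic f 2,
      forall x : R, derivable f x 1,
      forall x : R, derivable (f^`()) x 1
    & continuous (f^`(2))].

(* The mass is normalized on [0, 1], not on [-1, 1]. *)
Definition Pe (R : realType) (rho : R -> R) : Prop :=
  [/\ forall x : R, -1 <= x <= 1 -> 0 <= rho x,
      (@lebesgue_measure R).-integrable `[0, 1] (EFin \o rho),
      \int[@lebesgue_measure R]_(x in `[0, 1]) rho x = 1
    & forall x : R, -1 <= x <= 1 -> rho (- x) = rho x].

Definition w (R : realType) (r xi : R) : R := if `|xi| <= r then xi else 0.

Definition wconv (R : realType) (r : R) (f : R -> R) (x : R) : R :=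
  \int[@lebesgue_measure R]_y (w r (x - y) * f y).

Definition G (R : realType) (r M : R) (rho_r rho : R -> R) : R -> R :=
  wconv r (fun y => rho y + M * rho_r y).

(* The derivability clause is needed because derive1 is total. *)
Definition stationary_solution (R : realType) (r M sigma : R)
    (rho_r rho : R -> R) : Prop :=
  [/\ C2ep rho, Pe rho, forall x : R, 0 < rho x
    & forall x : R,
        derivable (fun y => rho y * G r M rho_r rho y) x 1 /\
        sigma ^+ 2 / 2 * rho^`(2)%classic x
          + (fun y => rho y * G r M rho_r rho y)^`()%classic x = 0].

Definition sigma_b2 (R : realType) (r M : R) : R :=
  4 * r / pi * (M + r / Num.sqrt 3 + 2).

Definition c_b (R : realType) (r M : R) : R :=
  4 * r ^+ 2 * M / (pi * Num.sqrt 3).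

(* Main.v *)
Require Import Defs.
From mathcomp Require Import all_boot all_order all_algebra.
From mathcomp Require Import all_classical all_reals all_analysis.
From mathcomp Require Import measurable_realfun.
From mathcomp Require Import ring lra.
Import Order.TTheory GRing.Theory Num.Theory.
Import numFieldNormedType.Exports.
Local Open Scope classical_set_scope.
Local Open Scope ring_scope.
Set Implicit Arguments.
Unset Strict Implicit.
Unset Printing Implicit Defensive.

(** Write f for the density rho + M rho_r and s for sigma^2 / 2. By evenness the
    flux s rho' + rho (w * f), which the stationary equation makes constant,
    vanishes at 0. A stationary density is thus one with s rho' = - rho (w * f),
    that is, a positive multiple of exp (- (W * f) / s), where W is the even
    primitive of w supported in the interaction range.

    Existence. The map sending rho to the normalized density
    exp (- (W * f) / s) has a variational structure, because W is even: its fixed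
    points are the critical points of the free energy, the integral of
    s rho ln rho + rho (W * rho) / 2 + M rho (W * rho_r). The drift w * f is
    bounded by 2 r (1 + M) whatever the density of f ([norm_drift_le]), so the map
    sends every even density into one convex class of functions with common
    bounds and Lipschitz constant ([gibbs_admissible]). That class is compact, and
    the free energy attains its minimum there ([free_energy_minimizer]). The
    segment from the minimizer g to its image p stays in the class, and the free
    energy starts along it with slope s times the integral of
    (p - g) (ln g - ln p), which is negative unless p = g; hence g is a fixed
    point ([free_energy_minimizer_gibbs]). Compactness of a set of Lipschitz
    functions together with this convexity takes the place of a fixed point
    theorem.

    Estimate. Let u = rho - 1 and let g be the primitive of u with g 0 = 0; by
    evenness and normalization g vanishes at -1, 0 and 1. Integrating s rho'
    against g gives s |u|^2 as the integral of g rho (w * f), all norms being those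
    of L^2. Since w * 1 = 0, w * f = w * u + M w * rho_r. In rho = 1 + u, the first
    term contributes at most r^2 |g| (|u| + M |rho_r|), since w has integral norm
    r^2 ([norm_itg_drift_le]), and the second at most 2 r (1 + M) |g| |u|. Wirtinger's
    inequality on the two halves of the period, pi |g| <= |u| ([nrm_prim_le]),
    then bounds s pi |u| by (r^2 + 2 r (1 + M)) |u| + M r^2 |rho_r|
    ([energy_estimate]), and the threshold on sigma absorbs the first term.

    Integrals are handled through primitives of continuous functions. Identities
    between them are then identities between functions with equal derivatives. *)

(** * Calculus of continuous and derivable functions *)
Section Derivatives.
Context {R : realType}.
Implicit Types (f g : R -> R) (a b c x : R).

Lemma continuousD_fun f g :
  continuous f -> continuous g -> continuous (fun x => f x + g x).
Proof. by move=> cf cg x; apply: (@continuousD _ _ _ f g); [exact: cf|exact: cg]. Qed.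

Lemma continuousN_fun f : continuous f -> continuous (fun x => - f x).
Proof. by move=> cf x; apply: (@continuousN _ _ _ f); exact: cf. Qed.

Lemma continuousM_fun f g :
  continuous f -> continuous g -> continuous (fun x => f x * g x).
Proof. by move=> cf cg x; apply: (@continuousM _ _ f g); [exact: cf|exact: cg]. Qed.

Lemma continuousX_fun f n : continuous f -> continuous (fun x => f x ^+ n).
Proof.
move=> cf x; apply: (@continuous_comp _ _ _ f (fun y => y ^+ n)); first exact: cf.
exact: exprn_continuous.
Qed.

Lemma continuous_norm_fun f : continuous f -> continuous (fun x => `|f x|).
Proof.
by move=> cf x; apply: (@continuous_comp _ _ _ f Num.norm); [exact: cf|exact: norm_continuous].
Qed.

Lemma continuous_comp_fun f g :
  continuous f -> continuous g -> continuous (fun x => f (g x)).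
Proof. by move=> cf cg x; apply: (@continuous_comp _ _ _ g f); [exact: cg|exact: cf]. Qed.

Lemma continuous_cst_fun a : continuous (fun _ : R => a).
Proof. by move=> x; exact: cst_continuous. Qed.

Lemma continuous_id_fun : continuous (fun x : R => x).
Proof. by move=> x; exact: cvg_id. Qed.

Lemma is_derive_continuous f g :
  (forall x, is_derive x 1 f (g x)) -> continuous f.
Proof.
move=> fg x; apply/differentiable_continuous/derivable1_diffP.
exact: (@ex_derive _ _ _ _ _ _ _ (fg x)).
Qed.

Lemma is_deriveD_fun f g x a b : is_derive x 1 f a -> is_derive x 1 g b ->
  is_derive x 1 (fun y => f y + g y) (a + b).
Proof. by move=> fa gb; exact: (@is_deriveD _ _ _ f g). Qed.

Lemma is_deriveN_fun f x a : is_derive x 1 f a ->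
  is_derive x 1 (fun y => - f y) (- a).
Proof. by move=> fa; exact: (@is_deriveN _ _ _ f). Qed.

Lemma is_deriveB_fun f g x a b : is_derive x 1 f a -> is_derive x 1 g b ->
  is_derive x 1 (fun y => f y - g y) (a - b).
Proof. by move=> fa gb; exact: (@is_deriveB _ _ _ f g). Qed.

Lemma is_deriveM_fun f g x a b : is_derive x 1 f a -> is_derive x 1 g b ->
  is_derive x 1 (fun y => f y * g y) (a * g x + f x * b).
Proof.
move=> fa gb; apply: (is_derive_eq (is_deriveM fa gb)).
by rewrite /GRing.scale/= addrC [g x * a]mulrC.
Qed.

Lemma is_derive_comp_fun f g x a b :
  is_derive (g x) 1 f a -> is_derive x 1 g b ->
  is_derive x 1 (fun y => f (g y)) (a * b).
Proof. by move=> fa gb; exact: (@is_derive1_comp _ f g). Qed.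

Lemma is_derive_cst_fun a x : is_derive x 1 (fun _ : R => a) 0.
Proof. exact: is_derive_cst. Qed.

Lemma is_derive_id_fun x : is_derive x 1 (fun y : R => y) 1.
Proof. exact: is_derive_id. Qed.

Lemma is_derive_eq_val f x a b : is_derive x 1 f a -> a = b -> is_derive x 1 f b.
Proof. by move=> + <-. Qed.

Lemma is_derive_derivable f x a : is_derive x 1 f a -> derivable f x 1.
Proof. by case. Qed.

Lemma is_derive_derive1 f x a : is_derive x 1 f a -> (f^`())%classic x = a.
Proof. by move=> [_]; rewrite derive1E. Qed.

End Derivatives.

(** * Primitives and signed integrals *)

Section Primitive.
Context {R : realType}.
Implicit Types (f g F G : R -> R) (a b c x : R).
Local Notation mu := (@lebesgue_measure R).

Lemma continuous_integrable f a b :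
  continuous f -> mu.-integrable `[a, b] (EFin \o f).
Proof.
move=> cf; apply: continuous_compact_integrable; first exact: segment_compact.
by apply: continuous_subspaceT => x; exact: cf.
Qed.

Lemma Rintegral_chasles f a b c : continuous f -> a <= b -> b <= c ->
  \int[mu]_(x in `[a, c]) f x =
  \int[mu]_(x in `[a, b]) f x + \int[mu]_(x in `[b, c]) f x.
Proof.
move=> cf ab bc.
have := @Rintegral_itvB R f (BLeft a) (BRight c) b (continuous_integrable _ _ cf).
rewrite !bnd_simp => /(_ ab bc) => h.
rewrite -(@Rintegral_itv_obnd_cbnd R b (BRight c) f); last first.
  apply: integrableS (continuous_integrable b c cf) => //.
  by apply: subset_itvr; rewrite bnd_simp.
by rewrite -h addrC subrK.
Qed.

(** The lower bound is 0 and the upper bound may be negative, so that one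
    primitive serves for all intervals. *)
Definition prim f x : R :=
  if 0 <= x then \int[mu]_(t in `[0, x]) f t else - \int[mu]_(t in `[x, 0]) f t.

Lemma prim0 f : prim f 0 = 0.
Proof. by rewrite /prim lexx set_itv1 Rintegral_set1. Qed.

Lemma prim_from f a x : continuous f -> a <= 0 -> a <= x ->
  prim f x = \int[mu]_(t in `[a, x]) f t - \int[mu]_(t in `[a, 0]) f t.
Proof.
move=> cf a0 ax; rewrite /prim; case: ifPn => [x0|].
  by rewrite (Rintegral_chasles cf a0 x0) addrC addKr.
rewrite -ltNge => /ltW x0.
by rewrite (Rintegral_chasles cf ax x0) opprD addrA subrr add0r.
Qed.

Lemma Rintegral_prim f a b : continuous f -> a <= b ->
  \int[mu]_(t in `[a, b]) f t = prim f b - prim f a.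
Proof.
move=> cf ab; pose m := Num.min a 0.
have ma : m <= a by rewrite ge_min lexx.
have m0 : m <= 0 by rewrite ge_min lexx orbT.
rewrite (prim_from cf m0 ma) (prim_from cf m0 (le_trans ma ab)).
by rewrite (Rintegral_chasles cf ma ab); ring.
Qed.

Lemma is_derive_prim f x : continuous f -> is_derive x 1 (prim f) (f x).
Proof.
move=> cf; pose m := Num.min x 0 - 1.
have mx : m < x by rewrite /m ltrBlDr (le_lt_trans (y := x)) ?ge_min ?lexx// ltrDl.
have m0 : m <= 0 by rewrite /m lerBlDr (le_trans (y := 0)) ?ge_min ?lexx ?orbT// addr0.
have [df fE] := @continuous_FTC1_closed R f m x (x + 1) ltac:(by rewrite ltrDl)
  (continuous_integrable _ _ cf) mx (cf x).
apply: (@near_eq_is_derive _ _ _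
  (fun y => \int[mu]_(t in `[m, y]) f t - \int[mu]_(t in `[m, 0]) f t)).
  near=> y; rewrite (@prim_from f m)//.
  by near: y; exact: lt_le_nbhsr.
apply: is_derive_eq_val (is_deriveB_fun _ (is_derive_cst_fun _ _)) _.
  exact: derivableP.
by rewrite subr0 -derive1E fE.
Unshelve. all: by end_near. Qed.

Lemma continuous_prim f : continuous f -> continuous (prim f).
Proof. by move=> cf; apply: is_derive_continuous => x; exact: is_derive_prim. Qed.

End Primitive.

(* Decision procedures treat values of primitives as atoms; comparing two of
   them must not unfold the integral. *)
Global Opaque prim.

(** Follows the shape of the function; the leaves are functions whose continuity
    or derivative is a hypothesis, and their primitives. *)
Ltac cont :=
  lazymatch goal with
  | h : continuous ?f |- continuous ?f => exact h
  | h : forall x, is_derive x _ ?f _ |- continuous ?f => exact (is_derive_continuous h)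
  | |- continuous (fun _ => ?c) => exact (@continuous_cst_fun _ c)
  | |- continuous (fun y => y) => exact (@continuous_id_fun _)
  | |- continuous (fun y => @?u y + @?v y) => apply (@continuousD_fun _ u v); cont
  | |- continuous (fun y => - @?u y) => apply (@continuousN_fun _ u); cont
  | |- continuous (fun y => @?u y * @?v y) => apply (@continuousM_fun _ u v); cont
  | |- continuous (fun y => @?u y ^+ ?n) => apply (@continuousX_fun _ u n); cont
  | |- continuous (fun y => `|@?u y|) => apply (@continuous_norm_fun _ u); cont
  | |- continuous (prim ?f) => apply (@continuous_prim _ f); cont
  | |- continuous (fun y => prim ?f (@?u y)) =>
      apply (@continuous_comp_fun _ (prim f) u); [apply (@continuous_prim _ f)|]; cont
  | h : continuous ?f |- continuous (fun y => ?f (@?u y)) =>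
      apply (@continuous_comp_fun _ f u h); cont
  | h : forall x, is_derive x _ ?f _ |- continuous (fun y => ?f (@?u y)) =>
      apply (@continuous_comp_fun _ f u (is_derive_continuous h)); cont
  end.

(** The value of the derivative is left to unification, in the unsimplified form
    that the rules of calculus produce. *)
Ltac der :=
  lazymatch goal with
  | |- is_derive _ _ (fun _ => ?c) _ => exact (is_derive_cst_fun c _)
  | |- is_derive _ _ (fun y => y) _ => exact (is_derive_id_fun _)
  | |- is_derive _ _ (fun y => @?u y + @?v y) _ => eapply (@is_deriveD_fun _ u v); der
  | |- is_derive _ _ (fun y => - @?u y) _ => eapply (@is_deriveN_fun _ u); der
  | |- is_derive _ _ (fun y => @?u y * @?v y) _ => eapply (@is_deriveM_fun _ u v); der
  | |- is_derive _ _ (fun y => @?u y ^+ 2) _ => eapply (@is_deriveM_fun _ u u); der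
  | |- is_derive _ _ (prim ?f) _ => apply is_derive_prim; cont
  | |- is_derive _ _ (fun y => prim ?f y) _ => apply is_derive_prim; cont
  | |- is_derive _ _ (fun y => prim ?f (@?u y)) _ =>
      eapply (@is_derive_comp_fun _ (prim f) u); [apply is_derive_prim; cont|der]
  | h : forall x, is_derive x _ ?f _ |- is_derive _ _ ?f _ => eapply h
  | h : forall x, is_derive x _ ?f _ |- is_derive _ _ (fun y => ?f y) _ => eapply h
  | h : forall x, is_derive x _ ?f _ |- is_derive _ _ (fun y => ?f (@?u y)) _ =>
      eapply (@is_derive_comp_fun _ f u); [eapply h|der]
  end.

(** Leaves the equality between the derivative computed and the one wanted. *)
Ltac derive_to := eapply is_derive_eq_val; [der|].
Section SignedIntegral.
Context {R : realType}.
Implicit Types (f g F G : R -> R) (a b c x : R).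
Local Notation mu := (@lebesgue_measure R).

(** Through primitives rather than over a set: the bounds need not be ordered,
    and linearity, substitution and integration by parts all follow from
    uniqueness of antiderivatives. *)
Definition itg a b f : R := prim f b - prim f a.

Lemma Rintegral_itg a b f : continuous f -> a <= b ->
  \int[mu]_(t in `[a, b]) f t = itg a b f.
Proof. exact: Rintegral_prim. Qed.

Lemma itg_FTC a b F f : continuous f -> (forall x, is_derive x 1 F (f x)) ->
  itg a b f = F b - F a.
Proof.
move=> cf dF; pose D x := prim f x - F x.
have : D b = D a.
  apply: is_derive_0_is_cst => x.
  apply: is_derive_eq_val (is_deriveB_fun (is_derive_prim x cf) (dF x)) _.
  by rewrite subrr.
by rewrite /D /itg => h; lra.
Qed.

Lemma itg_val a b F f v : continuous f -> (forall x, is_derive x 1 F (f x)) ->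
  F b - F a = v -> itg a b f = v.
Proof. by move=> cf dF <-; exact: itg_FTC. Qed.

Lemma eq_itg a b f g : f =1 g -> itg a b f = itg a b g.
Proof. by move=> /funext ->. Qed.

Lemma itg_chasles a b c f : itg a c f = itg a b f + itg b c f.
Proof. by rewrite /itg; ring. Qed.

Lemma itgD a b f g : continuous f -> continuous g ->
  itg a b (fun x => f x + g x) = itg a b f + itg a b g.
Proof.
move=> cf cg; apply: (@itg_val a b (fun x => prim f x + prim g x));
  [by cont| |by rewrite /itg; ring].
by move=> x; derive_to.
Qed.

Lemma itgZ a b c f : continuous f ->
  itg a b (fun x => c * f x) = c * itg a b f.
Proof.
move=> cf; apply: (@itg_val a b (fun x => c * prim f x)); [by cont| |by rewrite /itg; ring].
by move=> x; derive_to; ring.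
Qed.

Lemma itgN a b f : continuous f -> itg a b (fun x => - f x) = - itg a b f.
Proof.
by move=> cf; rewrite -mulN1r -itgZ//; apply: eq_itg => x; rewrite mulN1r.
Qed.

Lemma itgB a b f g : continuous f -> continuous g ->
  itg a b (fun x => f x - g x) = itg a b f - itg a b g.
Proof. by move=> cf cg; rewrite itgD ?itgN//; cont. Qed.

Lemma itg_cst a b c : itg a b (fun _ => c) = c * (b - a).
Proof.
apply: (@itg_val a b (fun x => c * x)); [by cont| |by ring].
by move=> x; derive_to; ring.
Qed.

Lemma le_itg a b f g : continuous f -> continuous g -> a <= b ->
  (forall x, a <= x <= b -> f x <= g x) -> itg a b f <= itg a b g.
Proof.
move=> cf cg ab fg; rewrite -!Rintegral_itg//; apply: le_Rintegral => //.
- exact: continuous_integrable.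
- exact: continuous_integrable.
Qed.

Lemma itg_ge0 a b f : continuous f -> a <= b ->
  (forall x, a <= x <= b -> 0 <= f x) -> 0 <= itg a b f.
Proof.
move=> cf ab f0; have -> : 0 = itg a b (fun _ => 0) by rewrite itg_cst mul0r.
by apply: le_itg => //; cont.
Qed.

Lemma itg_le_cst a b f c : continuous f -> a <= b ->
  (forall x, a <= x <= b -> f x <= c) -> itg a b f <= c * (b - a).
Proof. by move=> cf ab fc; rewrite -itg_cst; apply: le_itg => //; cont. Qed.

Lemma itg_ge_cst a b f c : continuous f -> a <= b ->
  (forall x, a <= x <= b -> c <= f x) -> c * (b - a) <= itg a b f.
Proof. by move=> cf ab fc; rewrite -itg_cst; apply: le_itg => //; cont. Qed.

Lemma norm_itg_le a b f g : continuous f -> continuous g -> a <= b ->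
  (forall x, a <= x <= b -> `|f x| <= g x) -> `|itg a b f| <= itg a b g.
Proof.
move=> cf cg ab fg; rewrite ler_norml -itgN//; apply/andP; split.
  apply: le_itg => //; first by cont.
  by move=> x /fg; rewrite ler_norml lerNl => /andP[].
by apply: le_itg => // x /fg; rewrite ler_norml => /andP[].
Qed.

Lemma norm_itg_le_cst a b f c : continuous f -> a <= b ->
  (forall x, a <= x <= b -> `|f x| <= c) -> `|itg a b f| <= c * (b - a).
Proof. by move=> cf ab fc; rewrite -itg_cst; apply: norm_itg_le => //; cont. Qed.

Lemma itg_shift a b c f : continuous f ->
  itg a b (fun x => f (x + c)) = itg (a + c) (b + c) f.
Proof.
move=> cf; apply: (@itg_val a b (fun x => prim f (x + c))); [by cont| |by []].
by move=> x; derive_to; ring.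
Qed.

Lemma itg_reflect a b c f : continuous f ->
  itg a b (fun x => f (c - x)) = itg (c - b) (c - a) f.
Proof.
move=> cf; apply: (@itg_val a b (fun x => - prim f (c - x)));
  [by cont| |by rewrite /itg; ring].
by move=> x; derive_to; ring.
Qed.

Lemma itg_by_parts a b F f G g : continuous f -> continuous g ->
  (forall x, is_derive x 1 F (f x)) -> (forall x, is_derive x 1 G (g x)) ->
  itg a b (fun x => F x * g x) =
  F b * G b - F a * G a - itg a b (fun x => f x * G x).
Proof.
move=> cf cg dF dG; apply/eqP; rewrite eq_sym subr_eq eq_sym -itgD; try by cont.
apply/eqP; apply: (@itg_val a b (fun x => F x * G x)) => //; first by cont.
by move=> x; apply: is_derive_eq_val (is_deriveM_fun (dF x) (dG x)) _; rewrite addrC.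
Qed.

Lemma itg_sqr_ge0 a b f : continuous f -> a <= b ->
  0 <= itg a b (fun x => f x ^+ 2).
Proof. by move=> cf ab; apply: itg_ge0 => // [|x _]; [cont|exact: sqr_ge0]. Qed.

(** Discriminant of the nonnegative quadratic form that sends (v, w) to the
    integral of (v f + w g)^2. *)
Lemma itg_cauchy_schwarz a b f g : continuous f -> continuous g -> a <= b ->
  itg a b (fun x => f x * g x) ^+ 2 <=
  itg a b (fun x => f x ^+ 2) * itg a b (fun x => g x ^+ 2).
Proof.
move=> cf cg ab.
set A := itg a b (fun x => f x ^+ 2); set B := itg a b _; set C := itg a b _.
have A0 : 0 <= A by exact: itg_sqr_ge0.
have C0 : 0 <= C by exact: itg_sqr_ge0.
have q s t : 0 <= s ^+ 2 * A + 2 * s * t * B + t ^+ 2 * C.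
  have -> : s ^+ 2 * A + 2 * s * t * B + t ^+ 2 * C =
      itg a b (fun x => (s * f x + t * g x) ^+ 2).
    rewrite /A /B /C -!itgZ; try by cont.
    rewrite -!itgD; try by cont.
    by apply: eq_itg => x; ring.
  by apply: itg_sqr_ge0 => //; cont.
(* The form takes the value C (A C - B^2) at (C, - B); when C = 0 it is affine
   in w at v = 1, and nonnegative only if B = 0. *)
have [C00|Cn0] := eqVneq C 0; last first.
  have Cp : 0 < C by rewrite lt_neqAle eq_sym Cn0.
  rewrite -subr_ge0 -(pmulr_rge0 _ Cp).
  by have -> : C * (A * C - B ^+ 2) = C ^+ 2 * A + 2 * C * - B * B + (- B) ^+ 2 * C
    by ring.
have [->|Bn0] := eqVneq B 0; first by rewrite expr0n mulr_ge0.
have := q 1 (- (A + 1) / (2 * B)); rewrite C00.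
have -> : 1 ^+ 2 * A + 2 * 1 * (- (A + 1) / (2 * B)) * B +
  (- (A + 1) / (2 * B)) ^+ 2 * 0 = -1 by field.
by rewrite ler0N1.
Qed.

End SignedIntegral.
(** * Even and periodic functions *)

Section PeriodicFunctions.
Context {R : realType}.
Implicit Types (f g k F G : R -> R) (a b c x C : R).

(** The primitive is nondecreasing with equal values at a and b, hence locally
    constant. *)
Lemma itg_eq0 a b f : continuous f -> (forall x, 0 <= f x) ->
  itg a b f = 0 -> forall x, a < x < b -> f x = 0.
Proof.
move=> cf f0 fab x /andP[ax xb].
have ndf y z : y <= z -> prim f y <= prim f z.
  by move=> yz; rewrite -subr_ge0; exact: itg_ge0.
have near_cst : \forall y \near x, prim f a = prim f y.
  near=> y; apply/eqP; rewrite eq_le ndf/=; last first.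
    by near: y; exact: lt_le_nbhsr.
  have -> : prim f a = prim f b by move: fab; rewrite /itg => h; lra.
  by apply: ndf; near: y; exact: lt_le_nbhsl.
have d0 := near_eq_is_derive near_cst (is_derive_cst_fun (prim f a) x).
have d1 := is_derive_prim x cf.
by rewrite -(@derive_val _ _ _ _ _ _ _ d1) (@derive_val _ _ _ _ _ _ _ d0).
Unshelve. all: by end_near. Qed.

Lemma periodic_itg f c : continuous f -> periodic f 2 ->
  itg (c - 1) (c + 1) f = itg (- 1) 1 f.
Proof.
move=> cf pf; pose D x := prim f (x + 1) - prim f (x - 1).
suff : D c = D 0 by rewrite /D sub0r add0r.
apply: is_derive_0_is_cst => x; rewrite /D; derive_to.
have -> : x + 1 = x - 1 + 2 by ring.
by rewrite pf; ring.
Qed.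

Lemma even_prim f x : continuous f -> even_fun f -> prim f (- x) = - prim f x.
Proof.
move=> cf ef; pose D x := prim f (- x) + prim f x.
have : D x = D 0.
  by apply: is_derive_0_is_cst => y; rewrite /D; derive_to; rewrite ef; ring.
by rewrite /D oppr0 prim0 => h; lra.
Qed.

Lemma odd_prim f x : continuous f -> (forall y, f (- y) = - f y) ->
  prim f (- x) = prim f x.
Proof.
move=> cf ef; pose D x := prim f (- x) - prim f x.
have : D x = D 0.
  by apply: is_derive_0_is_cst => y; rewrite /D; derive_to; rewrite ef; ring.
by rewrite /D oppr0 prim0 => h; lra.
Qed.

Lemma even_itg01 f : continuous f -> even_fun f ->
  itg (- 1) 1 f = 2 * itg 0 1 f.
Proof. by move=> cf ef; rewrite /itg even_prim// prim0; ring. Qed.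

Lemma periodic_prim f x : continuous f -> periodic f 2 ->
  itg (- 1) 1 f = 0 -> prim f (x + 2) = prim f x.
Proof.
move=> cf pf f0; have := periodic_itg (x + 1) cf pf.
rewrite f0 /itg addrK -addrA => /eqP; rewrite subr_eq0 => /eqP <-.
by congr prim; ring.
Qed.

(** One representative for all periodic functions at once, so that several of
    them can be moved to the fundamental domain together. *)
Lemma periodic_repr x :
  exists2 y, - 1 <= y < 1 & forall f, periodic f 2 -> f x = f y.
Proof.
have pM n f y : periodic f 2 -> f (y + 2 * n%:R) = f y.
  by move=> pf; rewrite mulr_natr periodicn.
set m := Num.floor ((x + 1) / 2).
have /andP[m1 m2] : m%:~R <= (x + 1) / 2 < (m + 1)%:~R by exact: floor_itv.
exists (x - 2 * m%:~R).
  by move: m1 m2; rewrite intrD => m1 m2; apply/andP; split; lra.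
move=> f pf; case: m {m1 m2} => n.
  by rewrite -[LHS](congr1 f (subrK (2 * n%:R) x)) pM.
by rewrite NegzE mulrNz mulrN opprK pM.
Qed.

Lemma periodic_bounded f : continuous f -> periodic f 2 ->
  exists2 C : R, 0 <= C & forall x, `|f x| <= C.
Proof.
move=> cf pf; have := @EVT_max R (fun x => `|f x|) (- 1) 1.
case; first by lra.
  by apply: continuous_subspaceT; cont.
move=> c _ fc; exists `|f c| => // x.
have [y /andP[y1 y2] ->//] := periodic_repr x.
by apply: fc; rewrite in_itv/= y1 ltW.
Qed.

End PeriodicFunctions.

(** * Exchange of integrals in correlations *)

Section Fubini.
Context {R : realType}.
Implicit Types (f g k F G : R -> R) (a b c d x : R).
Local Notation mu := (@lebesgue_measure R).

Lemma continuous_conv k f C a b : continuous k -> continuous f ->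
  (forall x, `|f x| <= C) -> a <= b ->
  continuous (fun x => itg a b (fun z => k z * f (x - z))).
Proof.
move=> ck cf fC ab x.
have -> : (fun x => itg a b (fun z => k z * f (x - z))) =
    (fun x => \int[mu]_(z in `[a, b]) (k z * f (x - z))).
  by apply/funext => y; rewrite Rintegral_itg//; cont.
apply: (@continuity_under_integral _ _ _ mu (fun x z => k z * f (x - z)) `[a, b]
  _ (x - 1) (x + 1) _ _ (fun z => `|k z| * C)) => //.
- by move=> y _; apply: continuous_integrable; cont.
- by apply: aeW => z _ y _; move: (y); change (continuous (fun y => k z * f (y - z))); cont.
- by apply: continuous_integrable; cont.
- by move=> y _; apply: aeW => z _; rewrite normrM ler_wpM2l.
- by rewrite inE/= in_itv/=; apply/andP; split; lra.
Qed.

Lemma continuous_cross g f C a b : continuous g -> continuous f ->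
  (forall x, `|f x| <= C) -> a <= b ->
  continuous (fun z => itg a b (fun x => g x * f (x - z))).
Proof.
move=> cg cf fC ab.
have -> : (fun z => itg a b (fun x => g x * f (x - z))) =
    (fun z => itg a b (fun x => g x * (fun y => f (- y)) (z - x))).
  by apply/funext => z; apply: eq_itg => x; rewrite opprB.
apply: (@continuous_conv g (fun y => f (- y)) C a b cg _ _ ab); first by cont.
by move=> x; exact: fC.
Qed.

Lemma integral_itg f a b : continuous f -> a <= b ->
  (\int[mu]_(x in `[a, b]) (f x)%:E)%E = (itg a b f)%:E.
Proof.
move=> cf ab; rewrite -Rintegral_itg// /Rintegral fineK//.
by apply: integrable_fin_num => //; exact: continuous_integrable.
Qed.

Lemma integral_restrict_itg f a b : continuous f -> a <= b ->
  (\int[mu]_x ((EFin \o f) \_ `[a, b]) x)%E = (itg a b f)%:E.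
Proof. by move=> cf ab; rewrite -integral_mkcond; exact: integral_itg. Qed.

(** The integrand, cut off outside the rectangle, is integrable for the product
    measure because it is bounded there. *)
Lemma itg_swap k g f C a b c d : continuous k -> continuous g -> continuous f ->
  (forall x, `|f x| <= C) -> a <= b -> c <= d ->
  itg a b (fun x => g x * itg c d (fun z => k z * f (x - z))) =
  itg c d (fun z => k z * itg a b (fun x => g x * f (x - z))).
Proof.
move=> ck cg cf fC ab cd.
pose T := measurableTypeR R.
pose h (p : T * T) : R := g p.1 * k p.2 * f (p.1 - p.2).
pose A : set (T * T) := `[a, b] `*` `[c, d].
have mA : measurable A by exact: measurableX.
have mh : measurable_fun setT h.
  apply: measurable_funM; first apply: measurable_funM.
  - by apply: measurableT_comp => //; exact: continuous_measurable_fun.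
  - by apply: measurableT_comp => //; exact: continuous_measurable_fun.
  - apply: (@measurableT_comp _ _ _ _ _ _ f); first exact: continuous_measurable_fun.
    by apply: measurable_funB.
have [Cg gC] : exists Cg, forall x, x \in `[a, b] -> `|g x| <= Cg.
  have [|m _ gm] := @EVT_max R (fun x => `|g x|) a b ab.
    by apply: continuous_subspaceT; cont.
  by exists `|g m|.
have [Ck kC] : exists Ck, forall x, x \in `[c, d] -> `|k x| <= Ck.
  have [|m _ gm] := @EVT_max R (fun x => `|k x|) c d cd.
    by apply: continuous_subspaceT; cont.
  by exists `|k m|.
have ih : (mu \x mu)%E.-integrable A (EFin \o h).
  apply: measurable_bounded_integrable => //.
  - have /= -> := @product_measure1E _ _ T T R mu mu `[a, b] `[c, d]
      (measurable_itv _) (measurable_itv _).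
    rewrite !lebesgue_measure_itv/= !lte_fin.
    by do 2 case: ifP => _; rewrite ?mule0 ?mul0e// -?EFinB -?EFinM ltry.
  - exact: measurable_funTS.
  - exists (Cg * Ck * C); split; first exact: num_real.
    move=> y yC [x z] [/= xab zcd]; rewrite (le_trans _ (ltW yC))// /h/= !normrM.
    by rewrite ler_pM ?ler_pM ?mulr_ge0 ?gC ?kC.
have iA : (mu \x mu)%E.-integrable setT ((EFin \o h) \_ A).
  by apply: (integrable_mkcond _ mA).1.
have cconv : continuous (fun x => itg c d (fun z => k z * f (x - z))).
  exact: continuous_conv cf fC cd.
have ccross := continuous_cross cg cf fC ab.
have /= := Fubini iA.
have -> : (fun x => \int[mu]_y ((EFin \o h) \_ A) (x, y))%E =
    (EFin \o (fun x => g x * itg c d (fun z => k z * f (x - z)))) \_ `[a, b].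
  apply/funext => x; rewrite [RHS]patchE; case: ifPn => xab; last first.
    rewrite integral0_eq// => y _; rewrite patchE ifF//.
    by apply: contraNF xab; rewrite in_setX => /andP[].
  transitivity (\int[mu]_(y in `[c, d]) (g x * (k y * f (x - y)))%:E)%E; last first.
    by rewrite integral_itg ?itgZ//; cont.
  rewrite [RHS]integral_mkcond; apply: eq_integral => y _.
  by rewrite !patchE in_setX xab/= /h/= mulrA.
have -> : (fun y => \int[mu]_x ((EFin \o h) \_ A) (x, y))%E =
    (EFin \o (fun z => k z * itg a b (fun x => g x * f (x - z)))) \_ `[c, d].
  apply/funext => y; rewrite [RHS]patchE; case: ifPn => ycd; last first.
    rewrite integral0_eq// => x _; rewrite patchE ifF//.
    by apply: contraNF ycd; rewrite in_setX => /andP[].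
  transitivity (\int[mu]_(x in `[a, b]) (k y * (g x * f (x - y)))%:E)%E; last first.
    by rewrite integral_itg ?itgZ//; cont.
  rewrite [RHS]integral_mkcond; apply: eq_integral => x _.
  by rewrite !patchE in_setX ycd andbT/= /h/= mulrCA mulrA.
have cl : continuous (fun x => g x * itg c d (fun z => k z * f (x - z))).
  exact: continuousM_fun.
have cr : continuous (fun z => k z * itg a b (fun x => g x * f (x - z))).
  exact: continuousM_fun.
rewrite (integral_restrict_itg cl ab).
rewrite (integral_restrict_itg cr cd).
move=> e; exact: EFin_inj e.
Qed.

End Fubini.
(** * The drift and its potential *)

Section L2norm.
Context {R : realType}.
Implicit Types (f g k : R -> R) (a b c d x r m : R).

Definition nrm f : R := Num.sqrt (itg (- 1) 1 (fun x => f x ^+ 2)).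

Lemma nrm_ge0 f : 0 <= nrm f.
Proof. exact: sqrtr_ge0. Qed.

Lemma nrm_sqr f : continuous f -> nrm f ^+ 2 = itg (- 1) 1 (fun x => f x ^+ 2).
Proof. by move=> cf; rewrite sqr_sqrtr// itg_sqr_ge0//; lra. Qed.

Lemma norm_itgM_le f g : continuous f -> continuous g ->
  `|itg (- 1) 1 (fun x => f x * g x)| <= nrm f * nrm g.
Proof.
move=> cf cg.
rewrite -(@ler_pXn2r _ 2) ?nnegrE ?mulr_ge0 ?nrm_ge0// exprMn !nrm_sqr//.
by rewrite real_normK ?num_real//; apply: itg_cauchy_schwarz => //; lra.
Qed.

End L2norm.

Section Drift.
Context {R : realType}.
Implicit Types (f g k : R -> R) (a b c d x r m : R).

Definition drift r f x : R := itg (- r) r (fun z => z * f (x - z)).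

(** The kernel is the even primitive of the one of [drift] that vanishes at both
    ends of the interaction range, so that no boundary term appears when [pot] is
    differentiated. *)
Definition pot r f x : R :=
  itg (- r) r (fun z => (z ^+ 2 - r ^+ 2) / 2 * f (x - z)).

Lemma wconvE r f : 0 <= r -> continuous f -> wconv r f = drift r f.
Proof.
move=> r0 cf; apply/funext => x; rewrite /wconv /drift.
pose h y := (x - y) * f y.
have ch : continuous h by rewrite /h; cont.
transitivity (itg (x - r) (x + r) h).
  rewrite -Rintegral_itg//; last by lra.
  rewrite [RHS]Rintegral_mkcond; apply: eq_Rintegral => y _.
  rewrite patchE /w /h mem_setE in_itv/= -ler_distl.
  by rewrite distrC; case: ifP => //; rewrite mul0r.
have := itg_reflect (- r) r x ch; rewrite opprK => <-.
by apply: eq_itg => z; rewrite /h; congr (_ * _); ring.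
Qed.

(** Integration by parts moves the kernel onto primitives of f, which makes the
    dependence on x and r explicit. *)
Lemma drift_primE r f x : continuous f ->
  drift r f x = prim (prim f) (x + r) - prim (prim f) (x - r)
                - r * (prim f (x + r) + prim f (x - r)).
Proof.
move=> cf.
refine (@itg_val _ (- r) r
  (fun z => - (z * prim f (x - z)) - prim (prim f) (x - z)) _ _ _ _ _).
- by cont.
- by move=> z; derive_to; ring.
- by rewrite opprK; ring.
Qed.

Lemma pot_primE r f x : continuous f ->
  pot r f x = prim (prim (prim f)) (x + r) - prim (prim (prim f)) (x - r)
              - r * (prim (prim f) (x + r) + prim (prim f) (x - r)).
Proof.
move=> cf.
refine (@itg_val _ (- r) r (fun z => - ((z ^+ 2 - r ^+ 2) / 2 * prim f (x - z))
   - z * prim (prim f) (x - z) - prim (prim (prim f)) (x - z)) _ _ _ _ _).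
- by cont.
- by move=> z; derive_to; field.
- move: (prim (prim (prim f))) (prim (prim f)) (prim f) => u v w.
  by rewrite opprK; ring.
Qed.

Lemma is_derive_drift r f x : continuous f ->
  is_derive x 1 (drift r f)
    (prim f (x + r) - prim f (x - r) - r * (f (x + r) + f (x - r))).
Proof.
move=> cf.
have -> : drift r f = fun x => prim (prim f) (x + r) - prim (prim f) (x - r)
                - r * (prim f (x + r) + prim f (x - r)).
  by apply/funext => y; exact: drift_primE.
by derive_to; ring.
Qed.

Lemma is_derive_pot r f x : continuous f -> is_derive x 1 (pot r f) (drift r f x).
Proof.
move=> cf; rewrite drift_primE//.
have -> : pot r f = fun x =>
    prim (prim (prim f)) (x + r) - prim (prim (prim f)) (x - r)
    - r * (prim (prim f) (x + r) + prim (prim f) (x - r)).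
  by apply/funext => y; exact: pot_primE.
by derive_to; ring.
Qed.

Lemma continuous_drift r f : continuous f -> continuous (drift r f).
Proof.
by move=> cf; apply: is_derive_continuous => x; exact: is_derive_drift.
Qed.

Lemma continuous_pot r f : continuous f -> continuous (pot r f).
Proof.
by move=> cf; apply: is_derive_continuous => x; exact: is_derive_pot.
Qed.

Lemma driftD r f g x : continuous f -> continuous g ->
  drift r (fun y => f y + g y) x = drift r f x + drift r g x.
Proof.
move=> cf cg; rewrite /drift -itgD; [|by cont|by cont].
by apply: eq_itg => z; rewrite mulrDr.
Qed.

Lemma driftZ r c f x : continuous f ->
  drift r (fun y => c * f y) x = c * drift r f x.
Proof.
move=> cf; rewrite /drift -itgZ; last by cont.
by apply: eq_itg => z; rewrite mulrCA.
Qed.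

Lemma potD r f g x : continuous f -> continuous g ->
  pot r (fun y => f y + g y) x = pot r f x + pot r g x.
Proof.
move=> cf cg; rewrite /pot -itgD; [|by cont|by cont].
by apply: eq_itg => z; rewrite mulrDr.
Qed.

Lemma potZ r c f x : continuous f ->
  pot r (fun y => c * f y) x = c * pot r f x.
Proof.
move=> cf; rewrite /pot -itgZ; last by cont.
by apply: eq_itg => z; rewrite mulrCA.
Qed.

Lemma drift_cst r c x : drift r (fun _ => c) x = 0.
Proof.
refine (@itg_val _ (- r) r (fun z => c / 2 * z ^+ 2) _ _ _ _ _).
- by cont.
- by move=> z; derive_to; field.
- by ring.
Qed.

Lemma drift_even r f x : continuous f -> even_fun f ->
  drift r f (- x) = - drift r f x.
Proof.
move=> cf ef; rewrite /drift -itgN; last by cont.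
have cq : continuous (fun z : R => - (z * f (x - z))) by cont.
have := itg_reflect (- r) r 0 cq; rewrite opprK sub0r add0r => <-.
apply: eq_itg => z; rewrite sub0r mulNr opprK -(ef (x - - z)).
by congr (_ * f _); ring.
Qed.

Lemma pot_even r f : continuous f -> even_fun f -> even_fun (pot r f).
Proof.
move=> cf ef x; rewrite /pot.
have cq : continuous (fun z : R => (z ^+ 2 - r ^+ 2) / 2 * f (x - z)) by cont.
have := itg_reflect (- r) r 0 cq; rewrite opprK sub0r add0r => <-.
apply: eq_itg => z; rewrite sub0r sqrrN -(ef (x - - z)).
by congr (_ * f _); ring.
Qed.

Lemma pot_periodic r f : periodic f 2 -> periodic (pot r f) 2.
Proof.
move=> pf x; apply: eq_itg => z; rewrite -[in RHS]pf; congr (_ * f _); ring.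
Qed.

End Drift.
(** * Bounds on the drift *)

Section DriftBounds.
Context {R : realType}.
Implicit Types (f g k : R -> R) (a b c d x r m C : R).

Lemma norm_drift_le1 r f x : continuous f -> periodic f 2 ->
  (forall y, 0 <= f y) -> 0 <= r <= 1 ->
  `|drift r f x| <= r * itg (- 1) 1 f.
Proof.
move=> cf pf f0 /andP[r0 r1].
apply: (@le_trans _ _ (itg (- r) r (fun z => r * f (x - z)))).
  apply: norm_itg_le; [by cont|by cont|by lra|].
  move=> z /andP[z1 z2]; rewrite normrM (ger0_norm (f0 _)) ler_wpM2r//.
  by rewrite ler_norml z1.
have cfx : continuous (fun z => f (x - z)) by cont.
rewrite itgZ// itg_reflect// opprK -(periodic_itg x cf pf) ler_wpM2l//.
rewrite (itg_chasles (x - 1) (x - r)) (itg_chasles (x - r) (x + r) (x + 1)).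
have : 0 <= itg (x - 1) (x - r) f by apply: itg_ge0 => //; lra.
have : 0 <= itg (x + r) (x + 1) f by apply: itg_ge0 => //; lra.
by lra.
Qed.

(** For r <= 1 the kernel is at most r on a window inside one period. Lowering the
    range by 1 and moving the point by 1, half a period, changes the drift only by
    two values of the primitive of f - m, each at most m in absolute value; so the
    bound grows by at most 2 m with each unit of range. *)
Lemma norm_drift_le r f m x : continuous f -> periodic f 2 -> even_fun f ->
  (forall y, 0 <= f y) -> itg (- 1) 1 f = 2 * m -> 0 <= r ->
  `|drift r f x| <= 2 * m * r.
Proof.
move=> cf pf ef f0 fm.
have base s y : 0 <= s <= 1 -> `|drift s f y| <= 2 * m * s.
  by move=> s01; have := norm_drift_le1 y cf pf f0 s01; rewrite fm; lra.
have prim1 : prim f 1 = m by move: fm; rewrite /itg even_prim//; lra.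
have prim_ge0 y : 0 <= y -> 0 <= prim f y.
  by move=> y0; have := itg_ge0 cf y0 (fun x _ => f0 x); rewrite /itg prim0 subr0.
pose h y := f y - m.
have ch : continuous h by rewrite /h; cont.
have ph : periodic h 2 by move=> y; rewrite /h pf.
have eh : even_fun h by move=> y; rewrite /h ef.
have hm y : prim h y = prim f y - m * y.
  have := itgB 0 y cf (@continuous_cst_fun _ m); rewrite itg_cst.
  by rewrite /itg !prim0 !subr0 => <-.
have h0 : itg (- 1) 1 h = 0 by rewrite itgB ?itg_cst ?fm; [ring|cont|cont].
have oH y : prim h (- y) = - prim h y by exact: even_prim.
have pH : periodic (prim h) 2 by move=> y; exact: periodic_prim.
have cH : continuous (prim h) by exact: continuous_prim.
have pHH : periodic (prim (prim h)) 2.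
  by move=> y; apply: periodic_prim => //; rewrite /itg odd_prim ?subrr.
have m0 : 0 <= m by rewrite -prim1 prim_ge0.
have H01 y : 0 <= y <= 1 -> `|prim h y| <= m.
  move=> /andP[y0 y1]; rewrite hm ler_norml.
  have := prim_ge0 _ y0.
  have : prim f y <= m.
    rewrite -prim1 -subr_ge0; apply: (@itg_ge0 _ y 1 f) => //.
  have : 0 <= m * y by rewrite mulr_ge0.
  have : m * y <= m by rewrite ler_piMr.
  by move=> *; apply/andP; split; lra.
have Hm y : `|prim h y| <= m.
  have [z /andP[z1 z2] ->//] := periodic_repr y.
  have [z0|z0] := leP 0 z; first by apply: H01; rewrite z0 ltW.
  by rewrite -normrN -oH H01//; apply/andP; split; lra.
have dE s y : drift s f y = drift s h y.
  have -> : f = (fun x => h x + m) by apply/funext => z; rewrite /h subrK.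
  by rewrite driftD ?drift_cst ?addr0//; cont.
have step s y :
    drift s h y = drift (s - 1) h (y + 1) - (prim h (y + s) + prim h (y - s)).
  rewrite !drift_primE//.
  have -> : y + 1 + (s - 1) = y + s by ring.
  have -> : y + 1 - (s - 1) = y - s + 2 by ring.
  by rewrite pH pHH; ring.
move=> r0; have [n rn] : exists n : nat, r <= n.+1%:R.
  by exists (Num.truncn r); apply/ltW/truncnS_gt.
elim: n => [|n ihn] in r x r0 rn *; first by apply: base; rewrite r0.
have [r1|r1] := leP r 1; first by apply: base; rewrite r0.
have := ihn (r - 1) (x + 1); rewrite !dE (step r x) => ih.
rewrite (le_trans (ler_normB _ _))//.
have {}ih : `|drift (r - 1) h (x + 1)| <= 2 * m * (r - 1).
  by apply: ih; [lra|rewrite -natr1 in rn; lra].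
have := ler_normD (prim h (x + r)) (prim h (x - r)).
by have := Hm (x + r); have := Hm (x - r); lra.
Qed.

(** Exchanging f and g reflects their correlation, and the kernel is even. *)
Lemma pot_sym r f g : 0 <= r -> continuous f -> continuous g ->
  periodic f 2 -> periodic g 2 ->
  itg (- 1) 1 (fun x : R => g x * pot r f x) = itg (- 1) 1 (fun x : R => f x * pot r g x).
Proof.
move=> r0 cf cg pf pg.
have [Cf _ fC] := periodic_bounded cf pf.
have [Cg _ gC] := periodic_bounded cg pg.
have r1 : - r <= r by lra.
have o1 : - 1 <= 1 :> R by lra.
have ck : continuous (fun z : R => (z ^+ 2 - r ^+ 2) / 2) by cont.
rewrite (itg_swap ck cg cf fC o1 r1) (itg_swap ck cf cg gC o1 r1).
have cc := continuous_cross cg cf fC o1.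
have cq : continuous (fun z : R => (z ^+ 2 - r ^+ 2) / 2 *
    itg (- 1) 1 (fun x : R => g x * f (x - z))) by exact: continuousM_fun.
have := itg_reflect (- r) r 0 cq; rewrite opprK sub0r add0r => <-.
apply: eq_itg => z; rewrite sub0r sqrrN; congr (_ * _).
have cp : continuous (fun y : R => f (y + z) * g y) by cont.
have pp : periodic (fun y : R => f (y + z) * g y) 2.
  by move=> y; rewrite pg addrAC pf.
transitivity (itg (- 1) 1 (fun x : R => f (x - z + z) * g (x - z))); last first.
  by apply: eq_itg => x; rewrite subrK.
have := itg_shift (- 1) 1 (- z) cp => /= ->.
have := periodic_itg (- z) cp pp; rewrite -[- z - 1]addrC -[- z + 1]addrC => ->.
by apply: eq_itg => x; rewrite opprK mulrC.
Qed.

(** After the exchange of integrals the kernel, of integral norm r^2, is applied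
    to the correlation of g and f, which Cauchy-Schwarz and invariance under
    translation bound by the product of the norms. *)
Lemma norm_itg_drift_le r f g : 0 <= r -> continuous f -> continuous g ->
  periodic f 2 ->
  `|itg (- 1) 1 (fun x : R => g x * drift r f x)| <= r ^+ 2 * (nrm g * nrm f).
Proof.
move=> r0 cf cg pf.
have [Cf _ fC] := periodic_bounded cf pf.
have r1 : - r <= r by lra.
have o1 : - 1 <= 1 :> R by lra.
rewrite (itg_swap (@continuous_id_fun R) cg cf fC o1 r1).
have cc := continuous_cross cg cf fC o1.
apply: (@le_trans _ _ (itg (- r) r (fun z : R => `|z| * (nrm g * nrm f)))).
  apply: norm_itg_le => //; [exact: (continuousM_fun (@continuous_id_fun R) cc)|by cont|].
  move=> z _; rewrite normrM ler_wpM2l//.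
  have cfz : continuous (fun x : R => f (x - z)) by cont.
  rewrite (le_trans (norm_itgM_le cg cfz))// ler_wpM2l ?nrm_ge0//.
  apply: ler_wsqrtr.
  have cf2 : continuous (fun x : R => f x ^+ 2) by cont.
  have pf2 : periodic (fun x : R => f x ^+ 2) 2 by move=> y; rewrite pf.
  have := itg_shift (- 1) 1 (- z) cf2 => /= ->.
  have := periodic_itg (- z) cf2 pf2.
  by rewrite -[- z - 1]addrC -[- z + 1]addrC => ->.
have cn : continuous (fun z : R => `|z|) by cont.
have -> : (fun z : R => `|z| * (nrm g * nrm f)) = (fun z : R => nrm g * nrm f * `|z|).
  by apply/funext => z; rewrite mulrC.
rewrite itgZ// mulrC ler_wpM2r ?mulr_ge0 ?nrm_ge0//.
have -> : itg (- r) r (fun z : R => `|z|) = 2 * itg 0 r (fun z : R => `|z|).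
  by rewrite /itg even_prim ?prim0; [ring|cont|move=> z; rewrite normrN].
have -> : r ^+ 2 = 2 * itg 0 r (fun z : R => z).
  suff -> : itg 0 r (fun z : R => z) = r ^+ 2 / 2 by field.
  refine (@itg_val _ 0 r (fun z => z ^+ 2 / 2) _ _ _ _ _); first by cont.
    by move=> z; derive_to; field.
  by field.
rewrite ler_pM2l//; apply: le_itg; [by cont|by cont|by []|].
by move=> z /andP[z0 _]; rewrite ger0_norm.
Qed.

End DriftBounds.
(** * Wirtinger inequality *)

Section Wirtinger.
Context {R : realType}.
Implicit Types (f g dg : R -> R) (a b x : R).

(** Completing the square with p x = l cot (l (x - a) + d), a solution of the
    Riccati equation p' = - l^2 - p^2: the derivative of g^2 p is at most
    g'^2 - l^2 g^2, and g^2 p vanishes at both ends. For l < pi the shift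
    d = (pi - l) / 2 keeps the argument of the cotangent inside ]0, pi[. *)
Lemma wirtinger_lt (l a : R) g dg : 0 < l < pi -> continuous dg ->
  (forall x, is_derive x 1 g (dg x)) -> g a = 0 -> g (a + 1) = 0 ->
  l ^+ 2 * itg a (a + 1) (fun x => g x ^+ 2) <=
  itg a (a + 1) (fun x => dg x ^+ 2).
Proof.
move=> /andP[l0 lpi] cdg hg ga ga1.
pose th x := l * (x - a) + (pi - l) / 2.
have s0 x : a <= x <= a + 1 -> 0 < sin (th x).
  move=> /andP[ax xa]; apply: sin_gt0_pi; rewrite /th.
  have h1 : 0 <= l * (x - a) by rewrite mulr_ge0 ?subr_ge0// ltW.
  have h2 : l * (x - a) <= l by apply: ler_piMr; [exact: ltW|lra].
  by apply/andP; split; lra.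
pose q x := dg x ^+ 2 - l ^+ 2 * g x ^+ 2.
have cq : continuous q by rewrite /q; cont.
pose D x := prim q x - g x ^+ 2 * (l * (cos (th x) * (sin (th x))^-1)).
have hD x : a <= x <= a + 1 ->
    is_derive x 1 D ((dg x - l * g x * cos (th x) / sin (th x)) ^+ 2).
  move=> /s0 sx; have sn0 : sin (th x) != 0 by rewrite gt_eqF.
  have dth : is_derive x 1 th l by rewrite /th; derive_to; ring.
  have dc : is_derive x 1 (fun x => cos (th x)) (- sin (th x) * l).
    by apply: is_derive_comp_fun dth; exact: is_derive_cos.
  have ds : is_derive x 1 (fun x => sin (th x)) (cos (th x) * l).
    by apply: is_derive_comp_fun dth; exact: is_derive_sin.
  have dv : is_derive x 1 (fun x => (sin (th x))^-1)
      (- (sin (th x)) ^- 2 * (cos (th x) * l)).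
    by have := @is_deriveV _ (fun x => sin (th x)) x _ _ sn0 ds.
  have dp := is_derive_prim x cq.
  have dg2 := is_deriveM_fun (hg x) (hg x).
  have dcs := is_deriveM_fun (is_derive_cst_fun l x) (is_deriveM_fun dc dv).
  apply: is_derive_eq_val (is_deriveB_fun dp (is_deriveM_fun dg2 dcs)) _.
  by rewrite /q; field.
have aa1 : a <= a + 1 by lra.
have [||c cab] := @MVT_segment R D
    (fun x => (dg x - l * g x * cos (th x) / sin (th x)) ^+ 2) a (a + 1) aa1.
- move=> x; rewrite in_itv/= => /andP[x1 x2]; apply: hD.
  by apply/andP; split; exact: ltW.
- apply: derivable_within_continuous => x; rewrite in_itv/= => xa.
  exact: (@ex_derive _ _ _ _ _ _ _ (hD x xa)).
rewrite /D ga ga1 !expr0n/= !mul0r !subr0 -/(itg a (a + 1) q) => e.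
have : 0 <= itg a (a + 1) q.
  by rewrite e mulr_ge0 ?sqr_ge0//; lra.
have cg := is_derive_continuous hg.
by rewrite itgB ?itgZ ?subr_ge0//; cont.
Qed.

Lemma wirtinger a g dg : continuous dg ->
  (forall x, is_derive x 1 g (dg x)) -> g a = 0 -> g (a + 1) = 0 ->
  pi ^+ 2 * itg a (a + 1) (fun x => g x ^+ 2) <=
  itg a (a + 1) (fun x => dg x ^+ 2).
Proof.
move=> cdg hg ga ga1; have cg := is_derive_continuous hg.
have aa1 : a <= a + 1 by lra.
set A := itg a (a + 1) (fun x => g x ^+ 2).
set B := itg a (a + 1) (fun x => dg x ^+ 2).
have A0 : 0 <= A by exact: itg_sqr_ge0.
have B0 : 0 <= B by exact: itg_sqr_ge0.
rewrite leNgt; apply/negP => BA.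
have pi2 : 0 < (pi : R) ^+ 2 by rewrite exprn_gt0// pi_gt0.
have Ap : 0 < A.
  by rewrite lt_neqAle A0 andbT; apply/eqP => A00; move: BA; rewrite -A00; lra.
pose m := (pi ^+ 2 + B / A) / 2.
have BA2 : B / A < pi ^+ 2 by rewrite ltr_pdivrMr.
have BA3 : 0 <= B / A by rewrite divr_ge0.
have m0 : 0 < m by rewrite /m; lra.
have mpi : m < pi ^+ 2 by rewrite /m; lra.
have := @wirtinger_lt (Num.sqrt m) a g dg.
rewrite sqrtr_gt0 m0 (sqr_sqrtr (ltW m0)) /= -/A -/B.
have -> : Num.sqrt m < pi.
  by rewrite -(@ltr_pXn2r _ 2) ?nnegrE ?sqrtr_ge0 ?pi_ge0// (sqr_sqrtr (ltW m0)).
move=> /(_ isT cdg hg ga ga1).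
have -> : m * A = (pi ^+ 2 * A + B) / 2 by rewrite /m; field; rewrite gt_eqF.
by lra.
Qed.

(** The primitive is odd, so it vanishes at -1 and 0 as well as at 1, and the
    inequality applies on each half of the period; this gives the constant pi,
    against pi / 2 for zeros at -1 and 1 only. *)
Lemma nrm_prim_le f : continuous f -> even_fun f -> prim f 1 = 0 ->
  pi * nrm (prim f) <= nrm f.
Proof.
move=> cf ef f1; have hp x := is_derive_prim x cf.
have cp : continuous (prim f) by exact: continuous_prim.
have fN1 : prim f (- 1) = 0 by rewrite even_prim// f1 oppr0.
rewrite -(@ler_pXn2r _ 2) ?nnegrE ?mulr_ge0 ?nrm_ge0 ?pi_ge0//.
rewrite exprMn !nrm_sqr// !(itg_chasles (- 1) 0 1) mulrDr.
have := @wirtinger 0 (prim f) f cf hp (prim0 f); rewrite add0r => /(_ f1).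
have := @wirtinger (- 1) (prim f) f cf hp fN1; rewrite addNr => /(_ (prim0 f)).
by lra.
Qed.

Lemma nrm_le (c : R) f g : continuous f -> continuous g -> 0 <= c ->
  (forall x, `|f x| <= c * `|g x|) -> nrm f <= c * nrm g.
Proof.
move=> cf cg c0 fg.
rewrite -(@ler_pXn2r _ 2) ?nnegrE ?mulr_ge0 ?nrm_ge0//.
rewrite exprMn !nrm_sqr// -itgZ; last by cont.
apply: le_itg; [by cont|by cont|by lra|] => x _.
rewrite -exprMn -[leLHS]real_normK ?num_real// -[leRHS]real_normK ?num_real//.
by rewrite ler_pXn2r ?nnegrE// normrM (ger0_norm c0).
Qed.

End Wirtinger.

(** * Distance of a stationary density to 1 *)

Section Estimate.
Context {R : realType}.
Implicit Types (f g rho rr d : R -> R) (r M x : R).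

(** The flux identity is tested against the primitive of u = rho - 1: the
    derivative term becomes s |u|^2, and in the drift term rho = 1 + u is split so
    that each part carries the norm of the primitive, which is at most |u| / pi. *)
Lemma energy_estimate (s r M : R) rr rho d : 0 <= r -> 0 <= M ->
  continuous rr -> periodic rr 2 -> even_fun rr -> (forall x, 0 <= rr x) ->
  itg (- 1) 1 rr = 2 ->
  continuous rho -> periodic rho 2 -> even_fun rho -> (forall x, 0 <= rho x) ->
  itg (- 1) 1 rho = 2 ->
  continuous d -> (forall x, is_derive x 1 rho (d x)) ->
  (forall x, s * d x + rho x * drift r (fun y => rho y + M * rr y) x = 0) ->
  s * pi * nrm (fun x => rho x - 1) <=
  (r ^+ 2 + 2 * r * (1 + M)) * nrm (fun x => rho x - 1) + M * r ^+ 2 * nrm rr.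
Proof.
move=> r0 M0 crr prr err rr0 irr crho prho erho rho0 irho cd hd eq.
set N := nrm (fun x => rho x - 1).
pose u x := rho x - 1.
have cu : continuous u by rewrite /u; cont.
have pu : periodic u 2 by move=> x; rewrite /u prho.
have eu : even_fun u by move=> x; rewrite /u erho.
have u1 : prim u 1 = 0.
  have : itg (- 1) 1 u = 0.
    by rewrite itgB ?itg_cst ?irho; [ring|by []|exact: continuous_cst_fun].
  by rewrite /itg even_prim//; lra.
have uN1 : prim u (- 1) = 0 by rewrite even_prim// u1 oppr0.
have du x : is_derive x 1 u (d x) by rewrite /u; derive_to; ring.
have dp x : is_derive x 1 (prim u) (u x) by exact: is_derive_prim.
have cp : continuous (prim u) by exact: continuous_prim.
pose D := drift r (fun y => rho y + M * rr y).
have cf : continuous (fun y => rho y + M * rr y) by cont.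
have cD : continuous D by exact: continuous_drift.
have cdu : continuous (drift r u) by exact: continuous_drift.
have cdr : continuous (drift r rr) by exact: continuous_drift.
have DE x : D x = drift r u x + M * drift r rr x.
  rewrite /D; have -> : (fun y => rho y + M * rr y) =
      (fun y => (u y + M * rr y) + 1) by apply/funext => y; rewrite /u; ring.
  by rewrite driftD ?drift_cst ?addr0 ?driftD ?driftZ//; cont.
have DC x : `|D x| <= 2 * (1 + M) * r.
  apply: norm_drift_le => //.
  - by move=> y; rewrite prho prr.
  - by move=> y; rewrite erho err.
  - by move=> y; rewrite addr_ge0// mulr_ge0.
  - by rewrite itgD ?itgZ ?irho ?irr//; [ring|cont].
set P := nrm (prim u).
have P0 : 0 <= P by exact: nrm_ge0.
have N0 : 0 <= N by exact: nrm_ge0.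
have PN : pi * P <= N by exact: nrm_prim_le.
have key : s * N ^+ 2 <= P * ((r ^+ 2 + 2 * r * (1 + M)) * N + M * r ^+ 2 * nrm rr).
  have -> : s * N ^+ 2 = itg (- 1) 1 (fun x => prim u x * drift r u x) +
      M * itg (- 1) 1 (fun x => prim u x * drift r rr x) +
      itg (- 1) 1 (fun x => prim u x * (u x * D x)).
    have := itg_by_parts (- 1) 1 cu cd dp du; rewrite u1 uN1 !mul0r subr0 sub0r => e.
    rewrite nrm_sqr// -[itg _ _ (fun x => _ ^+ 2)]opprK -e mulrN -mulNr -!itgZ//; try by cont.
    rewrite -!itgD; try by cont.
    apply: eq_itg => x; have e1 := eq x.
    have rhoE : rho x = u x + 1 by rewrite /u; ring.
    rewrite -/(D x) DE rhoE in e1.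
    have -> : - s * (prim u x * d x) = - (s * d x) * prim u x by ring.
    have -> : - (s * d x) = (u x + 1) * (drift r u x + M * drift r rr x) by lra.
    by rewrite DE; ring.
  have h1 := norm_itg_drift_le r0 cu cp pu.
  have h2 := norm_itg_drift_le r0 crr cp prr.
  have cuD : continuous (fun x => u x * D x) by cont.
  have h3 := norm_itgM_le cp cuD.
  have h4 : nrm (fun x => u x * D x) <= 2 * (1 + M) * r * N.
    have c0 : 0 <= 2 * (1 + M) * r by rewrite mulr_ge0// mulr_ge0// addr_ge0.
    apply: (nrm_le cuD cu c0).
    by move=> x; rewrite normrM mulrC ler_wpM2r.
  have l1 := le_trans (ler_norm _) h1.
  have l2 := ler_wpM2l M0 (le_trans (ler_norm _) h2).
  have l3 := le_trans (le_trans (ler_norm _) h3) (ler_wpM2l P0 h4).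
  apply: le_trans (lerD (lerD l1 l2) l3) _.
  by rewrite le_eqVlt -/P -/N; apply/orP; left; apply/eqP; ring.
have [N00|Nn0] := eqVneq N 0.
  by rewrite N00 !mulr0 add0r !mulr_ge0 ?sqr_ge0 ?nrm_ge0.
have Np : 0 < N by rewrite lt_neqAle eq_sym Nn0.
rewrite -(ler_pM2r Np).
have -> : s * pi * N * N = pi * (s * N ^+ 2) by ring.
apply: (le_trans (ler_wpM2l (pi_ge0 R) key)); rewrite mulrA mulrC ler_wpM2l//.
have c0 : 0 <= r ^+ 2 + 2 * r * (1 + M).
  by rewrite addr_ge0 ?sqr_ge0// mulr_ge0 ?mulr_ge0//; lra.
by apply: addr_ge0; rewrite mulr_ge0 ?nrm_ge0// mulr_ge0 ?sqr_ge0.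
Qed.

End Estimate.
Section L2normE.
Context {R : realType}.
Implicit Types (f : R -> R).
Local Notation mu := (@lebesgue_measure R).

Lemma integral_leb_Xt (g : measurableTypeR R -> \bar R) :
  measurable_fun setT g -> (forall x, (0 <= g x)%E) ->
  (\int[leb_Xt R]_x g x = \int[mu]_(x in `[(- 1 : R)%R, 1%R]) g x)%E.
Proof.
move=> mg g0; set I := [set` `[(- 1 : R)%R, 1%R]].
have mI : measurable (I : set (measurableTypeR R)) by exact: measurable_itv.
have mC := measurableC mI.
rewrite -[X in integral _ X _](setUv I) ge0_integral_setU//.
- rewrite [X in (_ + X)%E]null_set_integral ?adde0.
  + apply: eq_measure_integral => A mA AI.
    by rewrite /leb_Xt/= /mrestr setIidl.
  + exact: mC.
  + exact: measurable_funTS.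
  + by rewrite /leb_Xt/= /mrestr setICl measure0.
- by rewrite setUv.
- by apply/disj_setPS; rewrite setICr.
Qed.

Lemma L2normE f : continuous f -> L2norm f = (nrm f)%:E.
Proof.
move=> cf; rewrite /L2norm unlock /=.
have -> : (fun x : R => ((`|(f x)%:E| `^ 2)%E)) = (fun x => (f x ^+ 2)%:E).
  by apply/funext => x; rewrite /= powR_mulrn// real_normK ?num_real.
have cf2 : continuous (fun x => f x ^+ 2) by cont.
rewrite integral_leb_Xt ?integral_itg//.
- by rewrite /= powR12_sqrt// itg_sqr_ge0//; lra.
- apply/measurable_EFinP; exact: continuous_measurable_fun.
- by move=> x; rewrite lee_fin sqr_ge0.
Qed.

End L2normE.

Section StationarySolutions.
Context {R : realType}.
Implicit Types (f g rho rr d : R -> R) (r M x sigma : R).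

Lemma Pe_ge0 rho x : Pe rho -> periodic rho 2 -> 0 <= rho x.
Proof.
move=> [rho0 _ _ _] prho; have [y /andP[y1 y2] ->//] := periodic_repr x.
by rewrite rho0// y1 ltW.
Qed.

Lemma Pe_itg rho : Pe rho -> continuous rho -> even_fun rho -> itg (- 1) 1 rho = 2.
Proof.
move=> [_ _ irho _] crho erho; rewrite even_itg01// -Rintegral_itg ?irho ?mulr1//.
Qed.

Lemma even_derive0 f a : even_fun f -> is_derive (0 : R) 1 f a -> a = 0.
Proof.
move=> ef df.
have dN : is_derive (0 : R) 1 (fun x => - x) (- 1) by derive_to.
have df' : is_derive (- 0 : R) 1 f a by rewrite oppr0.
have := is_derive_comp_fun df' dN.
have -> : (fun x => f (- x)) = f by apply/funext => x; exact: ef.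
move=> [_ e]; have [_ e'] := df; move: e; rewrite e'; lra.
Qed.

(** The equation says that the flux is constant; at 0 it vanishes, the derivative
    of rho and the drift being odd. *)
Lemma stationary_flux r M sigma rr rho : 0 < r -> continuous rr -> even_fun rr ->
  stationary_solution r M sigma rr rho ->
  exists d, [/\ continuous d, forall x, is_derive x 1 rho (d x) &
    forall x, sigma ^+ 2 / 2 * d x
      + rho x * drift r (fun y => rho y + M * rr y) x = 0].
Proof.
move=> r0 crr err [[erho prho drho ddrho crho2] _ _ eq].
have hd x : is_derive x 1 rho (rho^`()%classic x) by rewrite derive1E; exact: derivableP.
have hdd x : is_derive x 1 (rho^`())%classic (rho^`(2)%classic x).
  by rewrite /= derive1E; exact: derivableP.
have cd : continuous (rho^`())%classic by exact: is_derive_continuous hdd.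
have crho : continuous rho by exact: is_derive_continuous hd.
exists (rho^`())%classic; split => // x.
set f := fun y => rho y + M * rr y.
have cf : continuous f by rewrite /f; cont.
have ef : even_fun f by move=> y; rewrite /f erho err.
have GE : G r M rr rho = drift r f by rewrite /G wconvE ?ltW.
pose Phi y := sigma ^+ 2 / 2 * rho^`()%classic y + rho y * drift r f y.
have : Phi x = Phi 0.
  apply: is_derive_0_is_cst => y; have [dG eqy] := eq y.
  rewrite GE in dG eqy; rewrite -eqy.
  apply: is_deriveD_fun.
  by rewrite derive1E; exact: derivableP.
rewrite /Phi => ->.
have -> : rho^`()%classic 0 = 0 by exact: even_derive0 (hd 0).
have := drift_even r 0 cf ef; rewrite oppr0 => e.
have -> : drift r f 0 = 0 by lra.
by rewrite !mulr0 addr0.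
Qed.

(** The energy estimate has r^2 where the threshold has 2 r^2 / sqrt 3, which is
    larger. If eta |u| exceeded the norm of rr, replacing the latter by eta |u| in
    the energy estimate would contradict the threshold. *)
Lemma stationary_L2_estimate r M sigma eta rr rho : 0 < r -> 0 <= M ->
  continuous rr -> even_fun rr -> periodic rr 2 -> Pe rr -> 0 < eta ->
  sigma_b2 r M + eta * c_b r M < sigma ^+ 2 ->
  stationary_solution r M sigma rr rho ->
  nrm (fun x => rho x - 1) <= eta^-1 * nrm rr.
Proof.
move=> r0 M0 crr err prr Prr eta0 big sol.
have [d [cd hd eq]] := stationary_flux r0 crr err sol.
have [[erho prho _ _ _] Prho _ _] := sol.
have crho : continuous rho by exact: is_derive_continuous hd.
have := energy_estimate (ltW r0) M0 crr prr err (fun x => Pe_ge0 x Prr prr)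
  (Pe_itg Prr crr err) crho prho erho (fun x => Pe_ge0 x Prho prho)
  (Pe_itg Prho crho erho) cd hd eq.
have := nrm_ge0 rr; have := nrm_ge0 (fun x => rho x - 1).
set N := nrm (fun x => rho x - 1); set Nr := nrm rr => N0 Nr0 est.
rewrite -(ler_pM2l eta0) mulrA mulfV ?gt_eqF// mul1r leNgt; apply/negP => NNr.
have Np : 0 < N by move: (le_lt_trans Nr0 NNr); rewrite pmulr_rgt0.
have pi0 : 0 < (pi : R) by exact: pi_gt0.
pose t : R := (Num.sqrt 3)^-1.
have t1 : 1 <= 2 * t.
  rewrite /t ler_pdivlMr ?sqrtr_gt0 ?ltr0n// mul1r.
  have -> : (2 : R) = Num.sqrt (2 ^+ 2) by rewrite sqrtr_sqr ger0_norm.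
  by apply: ler_wsqrtr; lra.
have {}big : 2 * r * (M + r * t + 2) + eta * (2 * r ^+ 2 * M * t)
    < sigma ^+ 2 / 2 * pi.
  have -> : 2 * r * (M + r * t + 2) + eta * (2 * r ^+ 2 * M * t) =
      (sigma_b2 r M + eta * c_b r M) * (pi / 2).
    have s3 : Num.sqrt 3 != 0 :> R by rewrite sqrtr_eq0 -ltNge ltr0n.
    rewrite /sigma_b2 /c_b /t; move: s3 (lt0r_neq0 pi0).
    by move: (Num.sqrt 3) pi => q p q0 p0; field; rewrite q0 p0.
  have -> : sigma ^+ 2 / 2 * pi = sigma ^+ 2 * (pi / 2) by field.
  by rewrite ltr_pM2r// divr_gt0.
move: {eq hd} big est; set S := sigma ^+ 2 / 2 * pi => big est.
have r2 : 0 <= r ^+ 2 by exact: sqr_ge0.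
have h1 : r ^+ 2 * 1 <= r ^+ 2 * (2 * t) by rewrite ler_wpM2l.
have h2 : eta * M * (r ^+ 2 * 1) <= eta * M * (r ^+ 2 * (2 * t)).
  by rewrite ler_wpM2l// mulr_ge0// ltW.
have h3 : r ^+ 2 + 2 * r * (1 + M) + eta * M * r ^+ 2 < S by move: big h1 h2 r0; lra.
have h4 : M * r ^+ 2 * Nr <= M * r ^+ 2 * (eta * N).
  by rewrite ler_wpM2l ?mulr_ge0// ltW.
have h5 : (r ^+ 2 + 2 * r * (1 + M) + eta * M * r ^+ 2) * N < S * N by rewrite ltr_pM2r.
by move: h4 h5 est; lra.
Qed.

End StationarySolutions.
(** * Compactness of Lipschitz functions *)

Section Selection.
Context {R : realType}.
Implicit Types (f g p : R -> R) (x y e : R).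

Lemma near_pointwise (p : prod_topology (fun _ : R => R)) (s : seq R) e : 0 < e ->
  nbhs p [set f | forall x, x \in s -> `|p x - f x| < e].
Proof.
move=> e0; elim: s => [|y s ih].
  have -> : [set f : prod_topology (fun _ : R => R) |
      forall x, x \in [::] -> `|p x - f x| < e] = setT by apply/seteqP; split.
  exact: filterT.
have hy : nbhs p [set f | ball (p y : R) e (f y)].
  exact: (@proj_continuous R (fun _ => R) y p _ (nbhsx_ballx (p y : R) e e0)).
apply: (@filterS _ (nbhs p) _ _ _ _ (@filterI _ (nbhs p) _ _ _ hy ih)).
by move=> f [/= fy fs] x; rewrite in_cons => /predU1P[->//|/fs].
Qed.

(** Arzela-Ascoli in the form used by the direct method: the box of functions
    bounded by b is compact for pointwise convergence, and for functions with a
    common Lipschitz constant closeness on a finite grid is closeness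
    everywhere. *)
Lemma lipschitz_selection (L b : R) (S : R -> set (R -> R)) :
  0 <= L ->
  (forall e, 0 < e -> S e !=set0) ->
  (forall e e', e <= e' -> S e `<=` S e') ->
  (forall e f, 0 < e -> S e f -> [/\ forall x, `|f x| <= b,
     forall x y, `|f x - f y| <= L * `|x - y| & periodic f 2]) ->
  exists g, forall e, 0 < e -> exists2 f, S e f & forall x, `|f x - g x| <= e.
Proof.
move=> L0 Sn0 Smono SP.
pose F : set_system (prod_topology (fun _ : R => R)) :=
  filter_from [set e | 0 < e] S.
have PF : ProperFilter F.
  apply: filter_from_proper; last by move=> e /Sn0.
  apply: filter_from_filter; first by exists 1 => /=.
  move=> e e' /= e0 e'0; exists (Num.min e e'); first by rewrite /= lt_min e0.
  by move=> f Sf; split; apply: Smono Sf; rewrite ge_min lexx ?orbT.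
have FA : F [set f | forall x : R, [set` `[- b, b]%R] (f x)].
  exists 1 => //= f /(SP _ _ ltr01)[fb _ _] x.
  by rewrite /= in_itv/= -ler_norml.
have [g [_ gF]] := @tychonoff R (fun _ => R) (fun _ => [set` `[- b, b]%R])
  (fun _ => @segment_compact R _ _) F PF FA.
have approx (s : seq R) e : 0 < e -> exists2 f, S e f &
    forall x, x \in s -> `|g x - f x| < e.
  move=> e0; have FS : F (S e) by exists e.
  by have [f [Sf fs]] := gF _ _ FS (near_pointwise g s e0); exists f.
have gLip x y : `|g x - g y| <= L * `|x - y|.
  apply/ler_addgt0Pr => e e0.
  have [f /SP[|_ fL _ fs]] := approx [:: x; y] (e / 2) ltac:(lra); first by lra.
  have hx := fs x ltac:(by rewrite !in_cons eqxx).
  have hy := fs y ltac:(by rewrite !in_cons eqxx orbT).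
  have -> : g x - g y = (g x - f x) + (f x - f y) - (g y - f y) by ring.
  rewrite (le_trans (ler_normB _ _))//.
  have := ler_normD (g x - f x) (f x - f y); have := fL x y; lra.
have pg : periodic g 2.
  move=> x; apply/eqP; rewrite -subr_eq0 -normr_le0; apply/ler_addgt0Pr => e e0.
  have [f /SP[|_ _ pf fs]] := approx [:: x; x + 2] (e / 2) ltac:(lra); first by lra.
  have hx := fs x ltac:(by rewrite !in_cons eqxx).
  have hy := fs (x + 2) ltac:(by rewrite !in_cons eqxx orbT).
  have -> : g (x + 2) - g x = (g (x + 2) - f (x + 2)) - (g x - f x).
    by rewrite pf; ring.
  by rewrite (le_trans (ler_normB _ _))//; lra.
exists g => e e0; pose h := e / (4 * (L + 1)).
have L1 : 0 < 4 * (L + 1) by lra.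
have h0 : 0 < h by rewrite divr_gt0.
have Lh : 2 * (L * h) <= e / 2.
  have -> : e / 2 = 2 * ((L + 1) * h) by rewrite /h; field; lra.
  by rewrite ler_pM2l//; apply: ler_wpM2r; [exact: ltW|lra].
pose n := Num.truncn (2 / h).
have [f Sf fs] := approx [seq - 1 + k%:R * h | k <- iota 0 n.+1] (e / 2) ltac:(lra).
have [e2 fL pf] : [/\ 0 < e / 2, forall x y, `|f x - f y| <= L * `|x - y|
    & periodic f 2].
  have e2 : 0 < e / 2 by lra.
  by have [] := SP _ _ e2 Sf.
exists f; first by apply: Smono Sf; lra.
move=> x; rewrite distrC.
have [y /andP[y1 y2] yE] := periodic_repr x; rewrite (yE g)// (yE f)//.
pose k := Num.truncn ((y + 1) / h).
have yh0 : 0 <= (y + 1) / h by apply: divr_ge0; [lra|exact: ltW].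
have /andP[k1 k2] := truncn_itv yh0.
rewrite -/k ler_pdivlMr// in k1; rewrite -/k ltr_pdivrMr// -natr1 in k2.
have kn : (k <= n)%N.
  by rewrite /k /n; apply: le_truncn; rewrite ler_pM2r ?invr_gt0//; lra.
pose z := - 1 + k%:R * h.
have zs : `|g z - f z| < e / 2.
  by apply: fs; apply/mapP; exists k => //; rewrite mem_iota add0n ltnS.
have yz : `|y - z| <= h.
  by rewrite ler_norml /z; apply/andP; split; lra.
have Lyz : L * `|y - z| <= L * h by rewrite ler_wpM2l.
have -> : g y - f y = (g y - g z) + (g z - f z) - (f y - f z) by ring.
rewrite (le_trans (ler_normB _ _))//.
have := ler_normD (g y - g z) (g z - f z); have := fL y z; have := gLip y z; lra.
Qed.

End Selection.
(** * Minimization of the free energy *)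

Section Logarithm.
Context {R : realType}.
Implicit Types (x y a b L : R) (f : R -> R).

Lemma continuous_ln_fun f : continuous f -> (forall x, 0 < f x) ->
  continuous (fun x => ln (f x)).
Proof.
move=> cf f0 x; apply: (@continuous_comp _ _ _ f (@ln R)); first exact: cf.
exact: continuous_ln.
Qed.

Lemma continuous_expR_fun f : continuous f -> continuous (fun x => expR (f x)).
Proof.
move=> cf x; apply: (@continuous_comp _ _ _ f (@expR R)); first exact: cf.
exact: continuous_expR.
Qed.

Lemma lnB_le x y : 0 < x -> 0 < y -> ln x - ln y <= (x - y) / y.
Proof.
move=> x0 y0; rewrite -ln_div ?posrE//.
have -> : (x - y) / y = x / y - 1 by field; rewrite gt_eqF.
have xy : 0 < x / y by rewrite divr_gt0.
rewrite -[X in ln X](subrK 1) addrC; apply: le_ln1Dx; lra.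
Qed.

(** The tangent at x to the convex function t ln t lies below its graph at y. *)
Lemma xlnx_tangent x y : 0 < x -> 0 < y ->
  x * ln x - y * ln y <= (x - y) * (1 + ln x).
Proof.
move=> x0 y0; have := ler_wpM2l (ltW y0) (lnB_le x0 y0).
have -> : y * ((x - y) / y) = x - y by field; rewrite gt_eqF.
by lra.
Qed.

Lemma ln_strong_monotone b x y : 0 < x <= b -> 0 < y <= b ->
  (x - y) ^+ 2 / b <= (x - y) * (ln x - ln y).
Proof.
wlog xy : x y / y <= x => [wl xb yb|].
  have [h|/ltW h] := leP y x; first exact: wl.
  by have := wl _ _ h yb xb; rewrite -[y - x]opprB sqrrN -[ln y - _]opprB mulrNN.
move=> /andP[x0 xb] /andP[y0 yb].
rewrite expr2 -mulrA ler_wpM2l ?subr_ge0//.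
have := lnB_le y0 x0; have -> : (y - x) / x = - ((x - y) / x) by ring.
have : (x - y) / b <= (x - y) / x.
  by rewrite ler_wpM2l ?subr_ge0// lef_pV2 ?posrE//; exact: lt_le_trans xb.
by lra.
Qed.

Lemma bounded_derive_lipschitz f (d : R -> R) L :
  (forall x, is_derive x 1 f (d x)) -> (forall x, `|d x| <= L) ->
  forall x y, `|f x - f y| <= L * `|x - y|.
Proof.
move=> df dL x y; wlog xy : x y / y <= x => [wl|].
  have [h|/ltW h] := leP y x; first exact: wl.
  by rewrite distrC (distrC x) wl.
have [|c _ ->] := @MVT_segment R f d y x xy (fun z _ => df z).
  by apply: continuous_subspaceT; exact: is_derive_continuous df.
by rewrite normrM ler_wpM2r.
Qed.

End Logarithm.

Section FreeEnergy.
Context {R : realType}.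
Variables (s r M : R) (rr : R -> R).
Implicit Types (f g h p : R -> R) (x y e a b L C : R).

(** For a suitable choice of a, b and L the Gibbs map sends this class into
    itself. It is convex, and compact for uniform convergence. *)
Definition admissible a b L f := [/\ even_fun f, periodic f 2,
  forall x, a <= f x <= b,
  forall x y, `|f x - f y| <= L * `|x - y| & itg (- 1) 1 f = 2].

Definition free_energy f : R := itg (- 1) 1 (fun x =>
  s * (f x * ln (f x)) + 2^-1 * (f x * pot r f x) + M * (f x * pot r rr x)).

Lemma lipschitz_continuous L f :
  (forall x y, `|f x - f y| <= L * `|x - y|) -> continuous f.
Proof.
move=> fL x; apply/cvgrPdist_le => e e0.
have L1 : 0 < `|L| + 1 by rewrite ltr_wpDl.
near=> y; rewrite (le_trans (fL x y))//.
rewrite (@le_trans _ _ ((`|L| + 1) * `|x - y|))//.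
  by rewrite ler_wpM2r// (le_trans (ler_norm L))// lerDl.
rewrite mulrC -ler_pdivlMr//; near: y.
by apply: cvgr_dist_le; [exact: cvg_id|rewrite divr_gt0].
Unshelve. all: by end_near. Qed.

Lemma norm_pot_le f C x : 0 <= r -> continuous f -> (forall y, `|f y| <= C) ->
  `|pot r f x| <= r ^+ 3 * C.
Proof.
move=> r0 cf fC; have -> : r ^+ 3 * C = r ^+ 2 / 2 * C * (r - - r) by field.
apply: norm_itg_le_cst; [by cont|by lra|].
move=> z /andP[z1 z2]; rewrite normrM; apply: ler_pM => //.
have z2r : z ^+ 2 <= r ^+ 2.
  by rewrite -subr_ge0 subr_sqr mulr_ge0//; lra.
rewrite ler_norml; have := sqr_ge0 z; have := sqr_ge0 r.
by move=> *; apply/andP; split; lra.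
Qed.

(** On [a, b] the function t ln t has bounded slope, and the interaction terms are
    quadratic and linear with a bounded kernel. *)
Lemma free_energy_lipschitz a b L : 0 < s -> 0 <= r -> 0 <= M ->
  continuous rr -> periodic rr 2 -> 0 < a -> 0 <= L -> exists2 C, 0 <= C &
  forall f g e, admissible a b L f -> admissible a b L g ->
  (forall x, `|f x - g x| <= e) -> free_energy g <= free_energy f + C * e.
Proof.
move=> s0 r0 M0 crr prr a0 L0.
have [B B0 rrB] := periodic_bounded crr prr.
pose l := `|ln a| + `|ln b|.
have l0 : 0 <= l by rewrite addr_ge0.
exists (2 * (s * (1 + l) + r ^+ 3 * `|b| + M * (r ^+ 3 * B))).
  by rewrite mulr_ge0// !addr_ge0// mulr_ge0 ?addr_ge0 ?exprn_ge0 ?mulr_ge0 ?exprn_ge0// ltW.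
move=> f g e [ef pf fab fL fi] [eg pg gab gL gi] fg.
have cf := lipschitz_continuous fL; have cg := lipschitz_continuous gL.
have f0 x : 0 < f x by have /andP[+ _] := fab x; exact: lt_le_trans.
have g0 x : 0 < g x by have /andP[+ _] := gab x; exact: lt_le_trans.
have b0 : 0 < b by have /andP[_] := fab 0; exact: lt_le_trans.
have fb x : `|f x| <= b by rewrite gtr0_norm//; have /andP[] := fab x.
have gb x : `|g x| <= b by rewrite gtr0_norm//; have /andP[] := gab x.
have lg x : `|ln (g x)| <= l.
  have /andP[ga gb'] := gab x.
  have h1 : ln a <= ln (g x) by rewrite ler_ln ?posrE.
  have h2 : ln (g x) <= ln b by rewrite ler_ln ?posrE.
  have := ler_norm (ln b); have := ler_norm (- ln a); rewrite normrN.
  have := normr_ge0 (ln a); have := normr_ge0 (ln b).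
  by rewrite ler_norml /l => *; apply/andP; split; lra.
have clf := continuous_ln_fun cf f0; have clg := continuous_ln_fun cg g0.
have cpf := continuous_pot (r := r) cf; have cpg := continuous_pot (r := r) cg.
have cpr := continuous_pot (r := r) crr.
have cgf : continuous (fun x => g x - f x) by cont.
have gfe x : `|g x - f x| <= e by rewrite distrC.
have e0 : 0 <= e by exact: le_trans (gfe 0).
rewrite addrC -lerBlDr /free_energy -itgB; [|by cont|by cont].
have -> : 2 * (s * (1 + l) + r ^+ 3 * `|b| + M * (r ^+ 3 * B)) * e =
  (s * (e * (1 + l)) + 2^-1 * (e * (r ^+ 3 * b) + b * (r ^+ 3 * e)) +
   M * (e * (r ^+ 3 * B))) * (1 - - 1).
  by rewrite gtr0_norm//; field.
apply: itg_le_cst; [by cont|by lra|] => x _.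
have t1 : g x * ln (g x) - f x * ln (f x) <= e * (1 + l).
  apply: (le_trans (xlnx_tangent (g0 x) (f0 x))).
  apply: (le_trans (ler_norm _)); rewrite normrM ler_pM//.
  by apply: (le_trans (ler_normD _ _)); rewrite normr1 lerD2l.
have prod_le (u v U V : R) : `|u| <= U -> `|v| <= V -> u * v <= U * V.
  by move=> uU vV; apply: (le_trans (ler_norm _)); rewrite normrM ler_pM.
have t2 : (g x - f x) * pot r g x <= e * (r ^+ 3 * b).
  by apply: prod_le => //; exact: norm_pot_le.
have t3 : f x * pot r (fun y => g y - f y) x <= b * (r ^+ 3 * e).
  by apply: prod_le => //; exact: norm_pot_le.
have t4 : (g x - f x) * pot r rr x <= e * (r ^+ 3 * B).
  by apply: prod_le => //; exact: norm_pot_le.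
have pE : pot r (fun y => g y - f y) x = pot r g x - pot r f x.
  rewrite (_ : (fun y => g y - f y) = (fun y => g y + (- 1) * f y)).
    by rewrite potD ?potZ//; [ring|cont].
  by apply/funext => y; ring.
rewrite pE in t3.
have t1' := ler_wpM2l (ltW s0) t1; have t4' := ler_wpM2l M0 t4.
by lra.
Qed.

(** Direct method: functions whose energies approach the infimum come uniformly
    close to one function, and the constraints and the energy pass to uniform
    limits. *)
Lemma free_energy_minimizer a b L : 0 < s -> 0 <= r -> 0 <= M ->
  continuous rr -> periodic rr 2 -> 0 < a -> a <= 1 <= b -> 0 <= L ->
  exists2 g, admissible a b L g &
    forall f, admissible a b L f -> free_energy g <= free_energy f.
Proof.
move=> s0 r0 M0 crr prr a0 /andP[a1 b1] L0.
have [C C0 EC] := free_energy_lipschitz b s0 r0 M0 crr prr a0 L0.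
have K1 : admissible a b L (fun _ => 1).
  split => //.
  - by move=> x; rewrite a1.
  - by move=> x y; rewrite subrr normr0 mulr_ge0.
  - by rewrite itg_cst; ring.
pose E := [set free_energy f | f in admissible a b L].
have Kcont f : admissible a b L f -> continuous f.
  by move=> [_ _ _ fL _]; exact: lipschitz_continuous fL.
have En0 : E !=set0 by exists (free_energy (fun _ => 1)); exists (fun _ => 1).
have Elb : has_lbound E.
  exists (free_energy (fun _ => 1) - C * b) => _ [f Kf <-].
  rewrite lerBlDr; apply: EC => // x; have [_ _ /(_ x)/andP[fa fb] _ _] := Kf.
  by rewrite ler_norml; apply/andP; split; lra.
pose S e := [set f | admissible a b L f /\ free_energy f <= inf E + e].
have [|||g gS] := @lipschitz_selection R L b S L0.
- move=> e e0; have [_ [f Kf <-] fe] := inf_adherent e0 (conj En0 Elb).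
  by exists f; split => //; exact: ltW.
- by move=> e e' ee' f [Kf fe]; split => //; rewrite (le_trans fe)// lerD2l.
- move=> e f e0 [[ef pf fab fL fi] fe]; split => // x.
  by have /andP[fa fb] := fab x; rewrite ger0_norm//; lra.
have lim0 u c : 0 <= c -> (forall e, 0 < e -> u <= c * e) -> u <= 0.
  move=> c0 h; apply/ler_addgt0Pr => e e0; rewrite add0r.
  have c1 : 0 < c + 1 by lra.
  have := h (e / (c + 1)) (divr_gt0 e0 c1).
  move=> /le_trans; apply; rewrite mulrCA ger_pMr// ler_pdivrMr//; lra.
have Kg : admissible a b L g.
  have gL x y : `|g x - g y| <= L * `|x - y|.
    rewrite -subr_le0; apply: (lim0 _ 2) => // e e0.
    have [f [[_ _ _ fL _] _] fg] := gS e e0.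
    have -> : g x - g y = (f x - f y) - (f x - g x) + (f y - g y) by ring.
    have := ler_normD (f x - f y - (f x - g x)) (f y - g y).
    have := ler_normB (f x - f y) (f x - g x).
    by have := fL x y; have := fg x; have := fg y; lra.
  have cg := lipschitz_continuous gL.
  split => //.
  - move=> x; apply/eqP; rewrite -subr_eq0 -normr_le0; apply: (lim0 _ 2) => // e e0.
    have [f [[ef _ _ _ _] _] fg] := gS e e0.
    have -> : g (- x) - g x = (f x - g x) - (f (- x) - g (- x)) by rewrite ef; ring.
    apply: (le_trans (ler_normB _ _)).
    by have := fg x; have := fg (- x); lra.
  - move=> x; apply/eqP; rewrite -subr_eq0 -normr_le0; apply: (lim0 _ 2) => // e e0.
    have [f [[_ pf _ _ _] _] fg] := gS e e0.
    have -> : g (x + 2) - g x = (f x - g x) - (f (x + 2) - g (x + 2)) by rewrite pf; ring.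
    apply: (le_trans (ler_normB _ _)).
    by have := fg x; have := fg (x + 2); lra.
  - move=> x; apply/andP; split; rewrite -subr_le0; apply: (lim0 _ 1) => // e e0;
      have [f [[_ _ /(_ x)/andP[fa fb] _ _] _] /(_ x)] := gS e e0;
      by rewrite ler_norml => /andP[? ?]; lra.
  - apply/eqP; rewrite -subr_eq0 -normr_le0; apply: (lim0 _ 2) => // e e0.
    have [f [Kf _] fg] := gS e e0; have cf := Kcont _ Kf.
    have [_ _ _ _ fi] := Kf; rewrite -[X in _ - X]fi -itgB//.
    have -> : 2 * e = e * (1 - - 1) by ring.
    apply: norm_itg_le_cst; [by cont|by lra|] => x _.
    by rewrite distrC.
exists g => // f Kf.
have mf : inf E <= free_energy f by apply: ge_inf => //; exists f.
rewrite (le_trans _ mf)// -subr_le0; apply: (lim0 _ (1 + C)); first by lra.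
move=> e e0; have [h [Kh he] hg] := gS e e0.
have := EC h g e Kh Kg hg; lra.
Qed.

End FreeEnergy.
(** * Gibbs states and existence *)

Section GibbsMap.
Context {R : realType}.
Implicit Types (f g h p rr : R -> R) (x y e a b c L C s r M : R).

(** Dividing by half of the integral over [-1, 1] gives an even density mass 1 on
    [0, 1]. Removing the value of the potential at 0 leaves the quotient unchanged
    and bounds both of its terms. *)
Definition gibbs s r f x : R :=
  expR (- ((pot r f x - pot r f 0) / s)) /
  (itg (- 1) 1 (fun y => expR (- ((pot r f y - pot r f 0) / s))) / 2).

Lemma is_derive_gibbs s r f x : continuous f ->
  is_derive x 1 (gibbs s r f) (- (drift r f x / s) * gibbs s r f x).
Proof.
move=> cf; rewrite /gibbs; set Z := _ / 2.
have dp y := is_derive_pot r y cf.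
have de y := @is_derive_expR R y.
by derive_to; ring.
Qed.

(** Within distance 1 of 0 the potential varies by at most c s, so the exponential
    and its mean both lie between expR (- c) and expR c. *)
Lemma gibbs_admissible s r f c : 0 < s -> continuous f -> even_fun f ->
  periodic f 2 -> (forall x, `|drift r f x| <= c * s) ->
  admissible (expR (- (2 * c))) (expR (2 * c)) (c * expR (2 * c)) (gibbs s r f).
Proof.
move=> s0 cf ef pf fc.
have c0 : 0 <= c by have := le_trans (normr_ge0 _) (fc 0); rewrite pmulr_lge0.
pose v x := - ((pot r f x - pot r f 0) / s).
have pv : periodic v 2 by move=> x; rewrite /v pot_periodic.
have vc x : `|v x| <= c.
  have [y /andP[y1 y2] ->//] := periodic_repr x.
  rewrite /v normrN normrM [`|s^-1|]gtr0_norm ?invr_gt0// ler_pdivrMr//.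
  have := bounded_derive_lipschitz (fun z => is_derive_pot r z cf) fc y 0.
  move=> /le_trans; apply; rewrite subr0 ler_piMr//.
    by rewrite mulr_ge0// ltW.
  by rewrite ler_norml y1 ltW.
have cv : continuous v.
  by have := continuous_pot (r := r) cf; rewrite /v => cp; cont.
have cE : continuous (fun x => expR (v x)) by exact: continuous_expR_fun.
have Eb x : expR (- c) <= expR (v x) <= expR c.
  by have := vc x; rewrite ler_norml !ler_expR.
pose Z := itg (- 1) 1 (fun y => expR (v y)) / 2.
have ec0 : 0 < expR (- c) by exact: expR_gt0.
have Zb : expR (- c) <= Z <= expR c.
  have o1 : - 1 <= 1 :> R by lra.
  have h1 := itg_ge_cst cE o1 (fun x _ => proj1 (andP (Eb x))).
  have h2 := itg_le_cst cE o1 (fun x _ => proj2 (andP (Eb x))).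
  by rewrite /Z; apply/andP; split; lra.
have Z0 : 0 < Z by apply: lt_le_trans ec0 _; have /andP[] := Zb.
have gE x : gibbs s r f x = expR (v x) / Z by [].
have ecN : expR (- c) = (expR c)^-1 by rewrite expRN.
have Zinv : expR (- c) <= Z^-1 <= expR c.
  have /andP[z1 z2] := Zb; apply/andP; split.
    by rewrite ecN lef_pV2 ?posrE ?expR_gt0.
  by rewrite -[leRHS]invrK -ecN lef_pV2 ?posrE.
have gb x : expR (- (2 * c)) <= gibbs s r f x <= expR (2 * c).
  have /andP[e1 e2] := Eb x; have /andP[z1 z2] := Zinv.
  have -> : - (2 * c) = - c + - c by ring.
  have -> : 2 * c = c + c by ring.
  by rewrite gE !expRD !ler_pM ?expR_ge0 ?invr_ge0// ltW.
split.
- by move=> x; rewrite /gibbs pot_even.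
- by move=> x; rewrite /gibbs pot_periodic.
- exact: gb.
- apply: bounded_derive_lipschitz (fun z => is_derive_gibbs s r z cf) _ => x.
  have /andP[g1 g2] := gb x.
  rewrite normrM normrN normrM [`|s^-1|]gtr0_norm ?invr_gt0//.
  have gibbs0 : 0 <= gibbs s r f x by apply: le_trans g1; exact: expR_ge0.
  rewrite [`|gibbs s r f x|]ger0_norm//; apply: ler_pM => //.
    by rewrite mulr_ge0// invr_ge0 ltW.
  by rewrite ler_pdivrMr.
- have -> : gibbs s r f = (fun x => Z^-1 * expR (v x)).
    by apply/funext => x; rewrite gE mulrC.
  have -> : itg (- 1) 1 (fun x => Z^-1 * expR (v x)) = Z^-1 * (2 * Z).
    by rewrite itgZ//; congr (_ * _); rewrite /Z; field.
  by field; rewrite gt_eqF.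
Qed.

Lemma ln_gibbs s r f : 0 < s -> continuous f ->
  exists k, forall x, pot r f x = k - s * ln (gibbs s r f x).
Proof.
move=> s0 cf; rewrite /gibbs; set Z := _ / 2.
have Z0 : 0 < Z.
  have cE : continuous (fun y => expR (- ((pot r f y - pot r f 0) / s))).
    apply: continuous_expR_fun; have := continuous_pot (r := r) cf => cp.
    by cont.
  rewrite divr_gt0// lt_neqAle itg_ge0//; try by lra.
    rewrite andbT eq_sym; apply/eqP => /(itg_eq0 cE) h.
    have : 0 = 0 :> R by [].
    have := h (fun x => expR_ge0 _) 0; rewrite ltr01 ltrN10 => /(_ isT)/eqP.
    by rewrite expR_eq0.
exists (pot r f 0 - s * ln Z) => x.
rewrite ln_div ?posrE ?expR_gt0// expRK; field.
by rewrite gt_eqF.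
Qed.

End GibbsMap.

Section Existence.
Context {R : realType}.
Implicit Types (f g h p rr : R -> R) (x y e a b c L C s r M : R).

(** Were D positive, the bound at t = D / (2 (D + c)) would read D <= D / 2. *)
Lemma le0_small_multiples (D c : R) : 0 <= c ->
  (forall t, 0 < t <= 2^-1 -> D <= t * (D + c)) -> D <= 0.
Proof.
move=> c0 D1; rewrite leNgt; apply/negP => D0.
have DB : 0 < D + c by rewrite ltr_wpDr.
have t01 : 0 < D / (2 * (D + c)) <= 2^-1.
  by rewrite divr_gt0 ?mulr_gt0//= ler_pdivrMr ?mulr_gt0//; lra.
have := D1 _ t01.
have -> : D / (2 * (D + c)) * (D + c) = D / 2 by field; rewrite gt_eqF.
by lra.
Qed.

(** Change of the density of the free energy from g to q = g + t (p - g): the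
    tangent at q bounds the entropy, and strong monotonicity of the logarithm
    compares ln q with ln p, through which the potential of g is expressed. On
    the right, the term linear in d and the one in g Vd - d Vg integrate to 0. *)
Lemma free_energy_density_segment (s b t k M g p q d Vg Vd Vr : R) :
  0 < s -> 0 < t < 1 -> d = p - g -> q = g + t * d ->
  0 < g <= b -> 0 < p <= b -> 0 < q <= b ->
  Vg + M * Vr = k - s * ln p ->
  s * (q * ln q) + 2^-1 * (q * (Vg + t * Vd)) + M * (q * Vr)
    - (s * (g * ln g) + 2^-1 * (g * Vg) + M * (g * Vr)) <=
  (t * (s + k)) * d + (- (s * (1 - t) * t / b)) * d ^+ 2
    + (t / 2) * (g * Vd - d * Vg) + (t ^+ 2 / 2) * (d * Vd).
Proof.
move=> s0 /andP[t0 t1] dE qE gb pb qb VE.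
have tn1 : 0 < 1 - t by lra.
have g0 : 0 < g by have /andP[] := gb.
have q0 : 0 < q by have /andP[] := qb.
have e1 : q - g = t * d by rewrite qE; ring.
have T1 := ler_wpM2l (ltW s0) (xlnx_tangent q0 g0); rewrite e1 in T1.
have T2 : (1 - t) * (d ^+ 2 / b) <= d * (ln p - ln q).
  have := ln_strong_monotone pb qb.
  have -> : p - q = (1 - t) * d by rewrite qE dE; ring.
  have -> : ((1 - t) * d) ^+ 2 / b = (1 - t) * ((1 - t) * (d ^+ 2 / b)) by ring.
  by rewrite -[X in _ <= X -> _]mulrA ler_pM2l.
have T3 := ler_wpM2l (mulr_ge0 (ltW s0) (ltW t0)) T2.
have e3 : M * (q * Vr) - M * (g * Vr) = t * d * (k - s * ln p - Vg).
  by rewrite -VE qE; ring.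
have e4 : q * (Vg + t * Vd) = g * Vg + t * (d * Vg) + t * (g * Vd) + t ^+ 2 * (d * Vd).
  by rewrite qE; ring.
rewrite e4; move: T1 T3 e3.
by clear; lra.
Qed.

(** On the segment from the minimizer g to its Gibbs state p, the free energy at
    time t exceeds its minimum by at most - t (1 - t) (s / b) A + t^2 B / 2, with A
    the integral of (p - g)^2 and B independent of t; dividing by t and letting t
    vanish gives A <= 0. *)
Lemma free_energy_minimizer_gibbs s r M rr a b L g : 0 < s -> 0 <= r ->
  continuous rr -> 0 < a -> admissible a b L g ->
  (forall f, admissible a b L f -> free_energy s r M rr g <= free_energy s r M rr f) ->
  admissible a b L (gibbs s r (fun y => g y + M * rr y)) ->
  gibbs s r (fun y => g y + M * rr y) = g.
Proof.
move=> s0 r0 crr a0 Kg gmin.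
set F := fun y => g y + M * rr y; set p := gibbs s r F => Kp.
have [eg pg gab gL gi] := Kg; have [ep pp pab pL pi'] := Kp.
have cg := lipschitz_continuous gL; have cp := lipschitz_continuous pL.
have cF : continuous F by rewrite /F; cont.
pose d x := p x - g x.
have cd : continuous d by rewrite /d; cont.
have pd : periodic d 2 by move=> x; rewrite /d pp pg.
have di : itg (- 1) 1 d = 0 by rewrite itgB// gi pi' subrr.
have cpg := continuous_pot (r := r) cg; have cpr := continuous_pot (r := r) crr.
have cpd := continuous_pot (r := r) cd.
have b0 : 0 < b by have /andP[h1 h2] := gab 0; exact: lt_le_trans (le_trans h1 h2).
have [k kE] := ln_gibbs r s0 cF.
pose A := itg (- 1) 1 (fun x => d x ^+ 2).
pose B := itg (- 1) 1 (fun x => d x * pot r d x).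
have cd2 : continuous (fun x => d x ^+ 2) by cont.
have A0 : 0 <= A by apply: itg_sqr_ge0 => //; lra.
have ineq t : 0 < t <= 2^-1 -> s * ((1 - t) * (A / b)) <= t * (B / 2).
  move=> /andP[t0 t1].
  pose q x := g x + t * d x.
  have qE x : q x = (1 - t) * g x + t * p x by rewrite /q /d; ring.
  have cq : continuous q by rewrite /q; cont.
  have tn1 : 0 < 1 - t by lra.
  have t1' := ltW tn1.
  have t01 : 0 < t < 1 by apply/andP; split; lra.
  have Kq : admissible a b L q.
    split.
    - by move=> x; rewrite !qE eg ep.
    - by move=> x; rewrite !qE pg pp.
    - move=> x; have /andP[g1 g2] := gab x; have /andP[p1 p2] := pab x.
      have := ler_wpM2l t1' g1; have := ler_wpM2l t1' g2.
      have := ler_wpM2l (ltW t0) p1; have := ler_wpM2l (ltW t0) p2.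
      by rewrite qE => *; apply/andP; split; lra.
    - move=> x y.
      have -> : q x - q y = (1 - t) * (g x - g y) + t * (p x - p y).
        by rewrite !qE; move: (g x) (g y) (p x) (p y) => gx gy px py; ring.
      apply: (le_trans (ler_normD _ _)).
      rewrite !normrM (ger0_norm t1') (gtr0_norm t0).
      have := ler_wpM2l t1' (gL x y); have := ler_wpM2l (ltW t0) (pL x y).
      by lra.
    - rewrite itgD ?itgZ ?di ?gi//; first by ring.
      by cont.
  have posK f : admissible a b L f -> forall x, 0 < f x <= b.
    by move=> [_ _ fab _ _] x; have /andP[f1 f2] := fab x; rewrite (lt_le_trans a0).
  have g0 x : 0 < g x by have /andP[] := posK _ Kg x.
  have q0 x : 0 < q x by have /andP[] := posK _ Kq x.
  have p0 x : 0 < p x by have /andP[] := posK _ Kp x.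
  have clg := continuous_ln_fun cg g0; have clq := continuous_ln_fun cq q0.
  have clp := continuous_ln_fun cp p0.
  have pqE x : pot r q x = pot r g x + t * pot r d x.
    by rewrite /q potD ?potZ//; cont.
  have cpq : continuous (pot r q) by exact: continuous_pot.
  have potF x : pot r g x + M * pot r rr x = k - s * ln (p x).
    by rewrite -kE /F potD ?potZ//; cont.
  have h := gmin _ Kq; rewrite -subr_ge0 /free_energy -itgB in h; [|by cont|by cont].
  have sym := pot_sym r0 cd cg pd pg.
  have := le_trans h (@le_itg _ (- 1) 1 _ (fun x =>
     (t * (s + k)) * d x + (- (s * (1 - t) * t / b)) * d x ^+ 2
     + (t / 2) * (g x * pot r d x - d x * pot r g x)
     + (t ^+ 2 / 2) * (d x * pot r d x)) _ _ _ _).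
  have -> : itg (- 1) 1 (fun x =>
     (t * (s + k)) * d x + (- (s * (1 - t) * t / b)) * d x ^+ 2
     + (t / 2) * (g x * pot r d x - d x * pot r g x)
     + (t ^+ 2 / 2) * (d x * pot r d x)) =
     - (s * (1 - t) * t / b) * A + (t ^+ 2 / 2) * B.
    rewrite !itgD ?itgZ ?itgB ?gi ?pi' ?sym; try by cont.
    by rewrite -/A -/B; ring.
  move=> fin; rewrite -(ler_pM2l t0) -subr_ge0.
  have -> : t * (t * (B / 2)) - t * (s * ((1 - t) * (A / b))) =
    - (s * (1 - t) * t / b) * A + (t ^+ 2 / 2) * B.
    by move: A B {A0 fin} => A' B'; field; rewrite gt_eqF.
  have o1 : - 1 <= 1 :> R by clear; lra.
  apply: fin; [by cont|by cont|exact: o1|] => x _; rewrite pqE.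
  exact: (free_energy_density_segment _ s0 t01 (erefl (d x)) (erefl (q x))
    (posK _ Kg x) (posK _ Kp x) (posK _ Kq x) (potF x)).
have sA : s * (A / b) <= 0.
  set D := s * (A / b).
  apply: (@le0_small_multiples D `|B|) => // t t01.
  have := ineq t t01; have /andP[t0 _] := t01.
  have := ler_wpM2l (ltW t0) (ler_norm B).
  have := mulr_ge0 (ltW t0) (normr_ge0 B).
  have -> : s * ((1 - t) * (A / b)) = (1 - t) * D by rewrite /D; ring.
  by move: (D) (`|B|) (B) => D' B' B''; clear; lra.
have A00 : A = 0.
  apply/eqP; rewrite eq_le A0 andbT; move: sA.
  by rewrite pmulr_rle0// pmulr_lle0// invr_gt0.
apply/funext => x; apply/eqP; rewrite -subr_eq0 -/(d x) -sqrf_eq0; apply/eqP.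
have pd2 : periodic (fun x => d x ^+ 2) 2 by move=> y; rewrite pd.
apply: (@itg_eq0 _ (x - 1) (x + 1) (fun x => d x ^+ 2)) => //.
- by move=> y; exact: sqr_ge0.
- by rewrite periodic_itg.
- by apply/andP; split; lra.
Qed.

(** The potential has derivative the drift, so a Gibbs state that is its own
    density satisfies s rho' = - rho (w * f); the right-hand side is again
    continuously derivable, which makes rho of class C^2. *)
Lemma gibbs_stationary r M sigma rr rho : 0 < r -> 0 < sigma ->
  continuous rr -> even_fun rr -> even_fun rho -> periodic rho 2 ->
  continuous rho -> (forall x, 0 < rho x) -> itg (- 1) 1 rho = 2 ->
  gibbs (sigma ^+ 2 / 2) r (fun y => rho y + M * rr y) = rho ->
  stationary_solution r M sigma rr rho.
Proof.
move=> r0 sigma0 crr err erho prho crho rho0 irho fixrho.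
set f := fun y => rho y + M * rr y in fixrho.
have cf : continuous f by rewrite /f; cont.
set s := sigma ^+ 2 / 2 in fixrho.
have s0 : 0 < s by rewrite divr_gt0 ?exprn_gt0.
have GE : G r M rr rho = drift r f by rewrite /G wconvE ?ltW.
have hd x : is_derive x 1 rho (- (drift r f x / s) * rho x).
  by have := is_derive_gibbs s r x cf; rewrite fixrho.
pose dD x := prim f (x + r) - prim f (x - r) - r * (f (x + r) + f (x - r)).
have hD x : is_derive x 1 (drift r f) (dD x) by exact: is_derive_drift.
have cdD : continuous dD by rewrite /dD; cont.
have cD : continuous (drift r f) by exact: continuous_drift.
have rho'E : (rho^`())%classic = fun x => - (drift r f x / s) * rho x.
  by apply/funext => x; exact: is_derive_derive1 (hd x).
pose flux' x := - (drift r f x / s) * rho x * drift r f x + rho x * dD x.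
have hflux x : is_derive x 1 (fun y => rho y * drift r f y) (flux' x).
  by derive_to.
have hrho' x : is_derive x 1 (rho^`())%classic (- s^-1 * flux' x).
  by rewrite rho'E /flux'; derive_to; ring.
have rho''E : rho^`(2)%classic = fun x => - s^-1 * flux' x.
  by apply/funext => x; exact: is_derive_derive1 (hrho' x).
split.
- split; [exact: erho|exact: prho| | |].
  + by move=> x; exact: is_derive_derivable (hd x).
  + by move=> x; exact: is_derive_derivable (hrho' x).
  + by rewrite rho''E /flux'; cont.
- split.
  + by move=> x _; exact: ltW.
  + exact: continuous_integrable.
  + by move: irho; rewrite Rintegral_itg// even_itg01//; lra.
  + by move=> x _; exact: erho.
- exact: rho0.
- move=> x; rewrite GE; split; first exact: is_derive_derivable (hflux x).
  rewrite (is_derive_derive1 (hflux x)) rho''E -/s.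
  by field; rewrite gt_eqF.
Qed.

Lemma exists_stationary r M sigma rr : 0 < r -> 0 <= M -> 0 < sigma ->
  continuous rr -> even_fun rr -> periodic rr 2 -> Pe rr ->
  exists rho, stationary_solution r M sigma rr rho.
Proof.
move=> r0 M0 sigma0 crr err prr Prr.
set s := sigma ^+ 2 / 2.
have s0 : 0 < s by rewrite divr_gt0 ?exprn_gt0.
have irr := Pe_itg Prr crr err.
pose c := 2 * (1 + M) * r / s.
have cs : c * s = 2 * (1 + M) * r by rewrite /c divfK// gt_eqF.
have c0 : 0 <= c by rewrite divr_ge0 ?ltW// !mulr_gt0// ltr_wpDr.
pose a := expR (- (2 * c)); pose b := expR (2 * c); pose L := c * b.
have a0 : 0 < a by exact: expR_gt0.
have ab : a <= 1 <= b.
  apply/andP; split; first by rewrite /a expR_le1; lra.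
  by rewrite /b -[leLHS]expR0 ler_expR; lra.
have L0 : 0 <= L by rewrite mulr_ge0 ?expR_ge0.
have [g Kg gmin] := free_energy_minimizer s0 (ltW r0) M0 crr prr a0 ab L0.
have [eg pg gab gL gi] := Kg; have cg := lipschitz_continuous gL.
have g0 x : 0 < g x by have /andP[+ _] := gab x; exact: lt_le_trans.
have cf : continuous (fun y => g y + M * rr y) by cont.
have ef : even_fun (fun y => g y + M * rr y) by move=> y; rewrite eg err.
have pf : periodic (fun y => g y + M * rr y) 2 by move=> y; rewrite pg prr.
exists g; apply: gibbs_stationary => //.
apply: (free_energy_minimizer_gibbs s0 (ltW r0) crr a0 Kg gmin).
apply: gibbs_admissible => // x; rewrite cs; apply: norm_drift_le => //.
- move=> y; apply: addr_ge0; first exact: ltW.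
  by apply: mulr_ge0 => //; exact: Pe_ge0.
- by rewrite itgD ?itgZ ?gi ?irr//; [ring|cont].
- exact: ltW.
Qed.

End Existence.
Unset Implicit Arguments.

Theorem theorem2p2 (R : realType) (r M sigma : R) (rho_r : R -> R)
    (r_gt0 : 0 < r) (M_ge0 : 0 <= M) (sigma_gt0 : 0 < sigma)
    (rho_r_H1 : H1ep rho_r) (rho_r_Pe : Pe rho_r) :
  (exists rho_s : R -> R, stationary_solution r M sigma rho_r rho_s) /\
  (forall eta : R, 0 < eta ->
     sigma_b2 r M + eta * c_b r M < sigma ^+ 2 ->
     forall rho_s : R -> R, stationary_solution r M sigma rho_r rho_s ->
       (L2norm (fun x => (rho_s x - 1)%R) <= (eta^-1)%:E * L2norm rho_r)%E).
Proof.
have [_ crr err prr] := rho_r_H1; split; first exact: exists_stationary.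
move=> eta eta0 big rho sol.
have [d [_ hd _]] := stationary_flux r_gt0 crr err sol.
rewrite !L2normE//; last by cont.
by rewrite -EFinM lee_fin; exact: stationary_L2_estimate sol.
Qed.
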